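(* Let $\omega\in\mathbb C$ be a primitive cube root of unity and let $r\in\mathbb C$ satisfy $r^3=1-\omega$. Let $\Gamma=\langle a,b\mid (ba)^3,(ab^{-1}a)^3,[ba,ab^{-1}a]\rangle$ and let $\pi\colon\Gamma\to\mathrm{PSL}_3(\mathbb Q(r))\subseteq\mathrm{PSL}_3(\mathbb C)$ be the homomorphism determined by (the classes modulo scalars of) $$\pi(a)=\begin{pmatrix}\omega r^2 & \frac{-2\omega-1}{3}r^2 & \frac{-\omega-2}{3}r^2\\ -r^2 & -\omega r^2 & \frac{-2\omega-1}{3}r^2\\ -(\omega+1)r^2 & r^2 & r^2\end{pmatrix},\qquad \pi(b)=\begin{pmatrix}0&0&\frac{\omega+2}{3}r\\ r&0&(\omega+1)r\\ 0&r&\omega r\end{pmatrix}.$$ Then $\pi(\Gamma)$ is an arithmetic lattice in $\mathrm{PSL}_3(\mathbb C)$.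
   Context: Notation: $[x,y]=xyx^{-1}y^{-1}$. The assignment for $\pi$ does extend to a homomorphism on $\Gamma$. A lattice in a locally compact group is a discrete subgroup of finite covolume; arithmetic here means commensurable with the arithmetic group $\mathrm{PSL}_3(\mathbb Z[\omega])\subseteq\mathrm{PSL}_3(\mathbb C)$ (commensurable: the intersection has finite index in both). *)

(* Defs.v *)
(* The complex numbers are R[i], for an arbitrary R : realType. *)
From HB Require Import structures.
From mathcomp Require Import all_boot all_order all_algebra.
From mathcomp Require Import complex.
From mathcomp Require Import all_classical all_reals.
From mathcomp Require Import topology normedtype measure.

Set Implicit Arguments.
Unset Strict Implicit.
Unset Printing Implicit Defensive.

Import Order.TTheory GRing.Theory Num.Theory.
Import numFieldTopology.Exports.

Local Open Scope classical_set_scope.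
Local Open Scope ring_scope.
Local Open Scope quotient_scope.

(* The letter [(x, true)] is the generator x, and [(x, false)] its inverse. *)
Definition word (I : Type) := seq (I * bool).

Definition winv (I : Type) (w : word I) : word I :=
  rev [seq (l.1, ~~ l.2) | l <- w].

(* [x, y] = x y x^-1 y^-1; the library's [~ x, y] is x^-1 y^-1 x y instead. *)
Definition wcomm (I : Type) (u v : word I) : word I :=
  u ++ v ++ winv u ++ winv v.

Inductive word_eq (I : Type) (rels : set (word I)) : word I -> word I -> Prop :=
| word_eq_refl w : word_eq rels w w
| word_eq_sym u v : word_eq rels u v -> word_eq rels v u
| word_eq_trans v u w :
    word_eq rels u v -> word_eq rels v w -> word_eq rels u w
| word_eq_cat u u' v v' :
    word_eq rels u u' -> word_eq rels v v' -> word_eq rels (u ++ v) (u' ++ v')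
| word_eq_cancel x e : word_eq rels [:: (x, e); (x, ~~ e)] [::]
| word_eq_rel w : rels w -> word_eq rels w [::].

Section Presentation.
Variables (I : choiceType) (rels : set (word I)).

Definition word_eqb : rel (word I) := fun u v => `[< word_eq rels u v >].

Lemma word_eqb_refl : reflexive word_eqb.
Proof. by move=> w; apply/asboolP; exact: word_eq_refl. Qed.

Lemma word_eqb_sym : symmetric word_eqb.
Proof. by move=> u v; apply/asboolP/asboolP; exact: word_eq_sym. Qed.

Lemma word_eqb_trans : transitive word_eqb.
Proof.
move=> v u w /asboolP uv /asboolP vw; apply/asboolP; exact: word_eq_trans vw.
Qed.

Canonical word_eqb_equiv :=
  EquivRel word_eqb word_eqb_refl word_eqb_sym word_eqb_trans.

Definition presented := {eq_quot word_eqb}.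
HB.instance Definition _ := Choice.on presented.

Definition presented_pi (w : word I) : presented :=
  \pi_{eq_quot word_eqb} w.

Lemma presented_piP u v :
  word_eq rels u v <-> presented_pi u = presented_pi v.
Proof.
by split=> [uv|/eqmodP/asboolP//]; apply/eqmodP/asboolP.
Qed.

Lemma presented_reprK (x : presented) : presented_pi (repr x) = x.
Proof. by rewrite /presented_pi reprK. Qed.

Lemma word_eq_repr w : word_eq rels (repr (presented_pi w)) w.
Proof. by apply/presented_piP; rewrite presented_reprK. Qed.

Lemma winv_cat (u v : word I) : winv (u ++ v) = winv v ++ winv u.
Proof. by rewrite /winv map_cat rev_cat. Qed.

Lemma winvK : involutive (@winv I).
Proof.
move=> w; rewrite /winv map_rev revK -map_comp -[RHS]map_id.
by apply: eq_map => -[x e] /=; rewrite negbK.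
Qed.

Lemma word_eq_mulwV w : word_eq rels (w ++ winv w) [::].
Proof.
elim: w => [|[x e] w IH]; first exact: word_eq_refl.
rewrite -[(x, e) :: w]/([:: (x, e)] ++ w) winv_cat.
apply: word_eq_trans (word_eq_cancel rels x e).
rewrite -catA [w ++ _]catA.
rewrite -[[:: (x, e); _]]/([:: (x, e)] ++ [::] ++ [:: (x, ~~ e)]).
by do 2?[apply: word_eq_cat => //; try exact: word_eq_refl].
Qed.

Lemma word_eq_mulVw w : word_eq rels (winv w ++ w) [::].
Proof. by rewrite -{2}[w]winvK; exact: word_eq_mulwV. Qed.

Definition presented_one : presented := presented_pi [::].
Definition presented_mul (x y : presented) : presented :=
  presented_pi (repr x ++ repr y).
Definition presented_inv (x : presented) : presented :=
  presented_pi (winv (repr x)).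

Lemma presented_mulE u v :
  presented_mul (presented_pi u) (presented_pi v) = presented_pi (u ++ v).
Proof. by apply/presented_piP/word_eq_cat; exact: word_eq_repr. Qed.

Lemma presented_mulA : associative presented_mul.
Proof.
move=> x y z; rewrite -(presented_reprK x) -(presented_reprK y).
by rewrite -(presented_reprK z) !presented_mulE catA.
Qed.

Lemma presented_mul1 : left_id presented_one presented_mul.
Proof. by move=> x; rewrite -(presented_reprK x) presented_mulE. Qed.

Lemma presented_mulx1 : right_id presented_one presented_mul.
Proof. by move=> x; rewrite -(presented_reprK x) presented_mulE cats0. Qed.

Lemma presented_mulV : left_inverse presented_one presented_inv presented_mul.
Proof.
move=> x; rewrite -{2}(presented_reprK x) presented_mulE.
exact/presented_piP/word_eq_mulVw.
Qed.

Lemma presented_mulxV : right_inverse presented_one presented_inv presented_mul.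
Proof.
move=> x; rewrite -{1}(presented_reprK x) presented_mulE.
exact/presented_piP/word_eq_mulwV.
Qed.

HB.instance Definition _ := isGroup.Build presented presented_mulA
  presented_mul1 presented_mulx1 presented_mulV presented_mulxV.

Definition presented_gen (x : I) : presented := presented_pi [:: (x, true)].

End Presentation.

(* Gamma = < a, b | (ba)^3, (a b^-1 a)^3, [ba, a b^-1 a] >, over the two
   generators a = true and b = false. *)
Definition wa : word bool := [:: (true, true)].
Definition wb : word bool := [:: (false, true)].
Definition wba : word bool := wb ++ wa.
Definition waVba : word bool := wa ++ winv wb ++ wa.

Definition Gamma_rels : set (word bool) :=
  [set w | w \in [:: wba ++ wba ++ wba;
                     waVba ++ waVba ++ waVba;
                     wcomm wba waVba]].

Definition Gamma := presented Gamma_rels.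
HB.instance Definition _ := Group.on Gamma.

Definition Gamma_a : Gamma := presented_gen Gamma_rels true.
Definition Gamma_b : Gamma := presented_gen Gamma_rels false.

Section Subgroups.
Variable G : groupType.
Local Open Scope group_scope.

Definition is_subgroup (H : set G) : Prop :=
  [/\ H 1, (forall x y, H x -> H y -> H (x * y)) & (forall x, H x -> H x^-1)].

Definition finite_index (H K : set G) : Prop :=
  finite_set [set [set h * k | k in K] | h in H].

Definition commensurable (H1 H2 : set G) : Prop :=
  finite_index H1 (H1 `&` H2) /\ finite_index H2 (H1 `&` H2).

End Subgroups.

(* As for the library's PreTopologicalNmodule, continuity of the operations is
   not part of the structure. *)
#[short(type="preTopologicalGroupType")]
HB.structure Definition PreTopologicalGroup :=
  {G of PointedTopological G & Group G}.

Section Lattice.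
Variables (R : realType) (G : preTopologicalGroupType).
Local Open Scope group_scope.
Local Open Scope ereal_scope.

Definition Borel : Type := g_sigma_algebraType (@open G).
HB.instance Definition _ := Measurable.on Borel.

(* Regularity is not required, as it is automatic for a locally finite Borel
   measure on a second countable locally compact Hausdorff space. *)
Definition left_haar_measure (mu : {measure set Borel -> \bar R}) : Prop :=
  [/\ (forall (g : G) (A : set G), measurable (A : set Borel) ->
         mu [set (g * x)%g | x in A] = mu A),
      (forall K : set G, compact K -> mu K < +oo)
    & 0 < mu setT].

(* F meets every coset L g in exactly one point. *)
Definition fundamental_domain (L F : set G) : Prop :=
  forall g : G, exists! x, F x /\ exists2 l, L l & g = (l * x)%g.

Definition discrete_subset (L : set G) : Prop := L `<=` isolated L.

(* A left Haar measure is invariant under left translation by L, so mu F does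
   not depend on the Borel fundamental domain F: it is the covolume of L. *)
Definition finite_covolume (L : set G) : Prop :=
  forall mu : {measure set Borel -> \bar R}, left_haar_measure mu ->
    exists F : set G,
      [/\ measurable (F : set Borel), fundamental_domain L F & mu F < +oo].

Definition is_lattice (L : set G) : Prop :=
  [/\ is_subgroup L, discrete_subset L & finite_covolume L].

End Lattice.

(* The norm topology of C, which the library attaches to the alias R[i]^o but
   not to R[i] itself. *)
#[non_forgetful_inheritance]
HB.instance Definition _ (R : realType) := PseudoPointedMetric.copy R[i] R[i]^o.

Section SpecialLinear.
Variables (R : realType) (n : nat).
Local Notation C := R[i].

Record SL := MkSL { SLval :> 'M[C]_n; SL_det : \det SLval == 1 }.

HB.instance Definition _ := [isSub for SLval].
HB.instance Definition _ := [Choice of SL by <:].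

Implicit Types M N : SL.

Definition SL_one : SL := @MkSL 1%:M (introT eqP (det1 _ n)).

Fact SL_mul_subproof M N : \det (M *m N) == 1.
Proof. by rewrite det_mulmx (eqP (SL_det M)) (eqP (SL_det N)) mulr1. Qed.
Definition SL_mul M N : SL := MkSL (SL_mul_subproof M N).

Fact SL_inv_subproof M : \det (invmx M) == 1.
Proof. by rewrite det_inv (eqP (SL_det M)) invr1. Qed.
Definition SL_inv M : SL := MkSL (SL_inv_subproof M).

Lemma SL_unit M : SLval M \in unitmx.
Proof. by rewrite unitmxE (eqP (SL_det M)) unitr1. Qed.

Lemma SL_mulA : associative SL_mul.
Proof. by move=> M N P; apply: val_inj; exact: mulmxA. Qed.
Lemma SL_mul1 : left_id SL_one SL_mul.
Proof. by move=> M; apply: val_inj; exact: mul1mx. Qed.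
Lemma SL_mulx1 : right_id SL_one SL_mul.
Proof. by move=> M; apply: val_inj; exact: mulmx1. Qed.
Lemma SL_mulV : left_inverse SL_one SL_inv SL_mul.
Proof. by move=> M; apply: val_inj; rewrite /= mulVmx // SL_unit. Qed.
Lemma SL_mulxV : right_inverse SL_one SL_inv SL_mul.
Proof. by move=> M; apply: val_inj; rewrite /= mulmxV // SL_unit. Qed.

HB.instance Definition _ :=
  isGroup.Build SL SL_mulA SL_mul1 SL_mulx1 SL_mulV SL_mulxV.

HB.instance Definition _ := Topological.copy SL (initial_topology SLval).
HB.instance Definition _ := isPointed.Build SL SL_one.

(* PSL_n(C) is the quotient of SL_n(C) by its scalar matrices. *)
Definition SL_scalar_eq : rel SL :=
  fun M N => `[< exists c : C, SLval M = c *: SLval N >].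

Lemma SL_scalar_neq0 (c : C) M N : SLval M = c *: SLval N -> (0 < n)%N -> c != 0.
Proof.
move=> MN n_gt0; apply/eqP => c0; move: (eqP (SL_det M)).
rewrite MN detZ c0 expr0n eqn0Ngt n_gt0 mul0r => /eqP.
by rewrite eq_sym oner_eq0.
Qed.

Lemma SL_scalar_eq_refl : reflexive SL_scalar_eq.
Proof. by move=> M; apply/asboolP; exists 1; rewrite scale1r. Qed.

Lemma SL_scalar_eq_sym : symmetric SL_scalar_eq.
Proof.
suff H M N : SL_scalar_eq M N -> SL_scalar_eq N M.
  by move=> M N; apply/idP/idP; exact: H.
move=> /asboolP[c MN]; apply/asboolP; exists c^-1; rewrite MN scalerA.
case: (posnP n) => [n0|n_gt0].
  by apply/matrixP => i; exfalso; case: i; rewrite n0.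
by rewrite mulVf ?scale1r //; exact: SL_scalar_neq0 MN n_gt0.
Qed.

Lemma SL_scalar_eq_trans : transitive SL_scalar_eq.
Proof.
move=> N M P /asboolP[c MN] /asboolP[d NP]; apply/asboolP.
by exists (c * d); rewrite MN NP scalerA.
Qed.

Canonical SL_scalar_equiv := EquivRel SL_scalar_eq
  SL_scalar_eq_refl SL_scalar_eq_sym SL_scalar_eq_trans.

Definition PSL := quotient_topology {eq_quot SL_scalar_eq}.
HB.instance Definition _ := Choice.on PSL.
HB.instance Definition _ := Quotient.on PSL.
HB.instance Definition _ := Topological.on PSL.

Definition PSL_class (M : SL) : PSL := \pi_{eq_quot SL_scalar_eq} M.
Definition PSL_repr (x : PSL) : SL := repr (x : {eq_quot SL_scalar_eq}).

Lemma PSL_classP M N :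
  (exists c : C, SLval M = c *: SLval N) <-> PSL_class M = PSL_class N.
Proof.
by split=> [MN|/eqmodP/asboolP//]; apply/eqmodP/asboolP.
Qed.

Lemma PSL_reprK (x : PSL) : PSL_class (PSL_repr x) = x.
Proof. by rewrite /PSL_class /PSL_repr reprK. Qed.

Definition PSL_one : PSL := PSL_class SL_one.
Definition PSL_mul (x y : PSL) : PSL :=
  PSL_class (SL_mul (PSL_repr x) (PSL_repr y)).
Definition PSL_inv (x : PSL) : PSL := PSL_class (SL_inv (PSL_repr x)).

Lemma PSL_mulE M N :
  PSL_mul (PSL_class M) (PSL_class N) = PSL_class (SL_mul M N).
Proof.
have [c Mc] := (PSL_classP _ _).2 (PSL_reprK (PSL_class M)).
have [d Nd] := (PSL_classP _ _).2 (PSL_reprK (PSL_class N)).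
apply/PSL_classP; exists (c * d).
by rewrite /= Mc Nd -scalemxAl -scalemxAr scalerA.
Qed.

Lemma PSL_mulA : associative PSL_mul.
Proof.
move=> x y z; rewrite -(PSL_reprK x) -(PSL_reprK y) -(PSL_reprK z).
by rewrite !PSL_mulE SL_mulA.
Qed.
Lemma PSL_mul1 : left_id PSL_one PSL_mul.
Proof. by move=> x; rewrite -(PSL_reprK x) PSL_mulE SL_mul1. Qed.
Lemma PSL_mulx1 : right_id PSL_one PSL_mul.
Proof. by move=> x; rewrite -(PSL_reprK x) PSL_mulE SL_mulx1. Qed.
Lemma PSL_mulV : left_inverse PSL_one PSL_inv PSL_mul.
Proof. by move=> x; rewrite -{2}(PSL_reprK x) PSL_mulE SL_mulV. Qed.
Lemma PSL_mulxV : right_inverse PSL_one PSL_inv PSL_mul.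
Proof. by move=> x; rewrite -{1}(PSL_reprK x) PSL_mulE SL_mulxV. Qed.

HB.instance Definition _ :=
  isGroup.Build PSL PSL_mulA PSL_mul1 PSL_mulx1 PSL_mulV PSL_mulxV.
HB.instance Definition _ := isPointed.Build PSL PSL_one.
HB.instance Definition _ := PreTopologicalGroup.on PSL.

(* x is the class modulo scalars of the matrix A (which has determinant 1). *)
Definition PSL_class_of (A : 'M[C]_n) (x : PSL) : Prop :=
  exists2 M : SL, SLval M = A & x = PSL_class M.

(* The image in PSL_n(C) of SL_n(S), for S a subring of C. *)
Definition PSL_over (S : set C) : set PSL :=
  [set PSL_class M | M in [set M : SL | forall i j, S (SLval M i j)]].

End SpecialLinear.

Definition Zadjoin (R : realType) (omega : R[i]) : set R[i] :=
  [set z | exists p : {poly int}, z = (map_poly intr p).[omega]].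

Definition arithmetic_lattice (R : realType) (omega : R[i])
    (L : set (PSL R 3)) : Prop :=
  is_lattice R L /\ commensurable L (PSL_over (Zadjoin omega)).

Definition mx3 (K : nzRingType) (rows : seq (seq K)) : 'M[K]_3 :=
  \matrix_(i < 3, j < 3) nth 0 (nth [::] rows i) j.

Definition mxA (R : realType) (omega r : R[i]) : 'M[R[i]]_3 := mx3 [::
  [:: omega * r ^+ 2; (- 2 * omega - 1) / 3 * r ^+ 2; (- omega - 2) / 3 * r ^+ 2];
  [:: - r ^+ 2; - omega * r ^+ 2; (- 2 * omega - 1) / 3 * r ^+ 2];
  [:: - (omega + 1) * r ^+ 2; r ^+ 2; r ^+ 2]].

Definition mxB (R : realType) (omega r : R[i]) : 'M[R[i]]_3 := mx3 [::
  [:: 0; 0; (omega + 2) / 3 * r];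
  [:: r; 0; (omega + 1) * r];
  [:: 0; r; omega * r]].

(* Main.v *)
Require Import Defs.
From HB Require Import structures.
From mathcomp Require Import all_boot all_order all_algebra.
From mathcomp Require Import complex.
From mathcomp Require Import all_classical all_reals.
From mathcomp Require Import topology normedtype sequences ereal measure.
From mathcomp Require Import ring lra zify ssrZ.

(** Notation: O = Z[omega], lambda = 1 - omega, so that 3 is a unit times
    lambda^2; P = PSL_3(O); a and b are the two given classes and L, the image
    of pi, is the group that they generate.

    Commensurability. The elements b^3, a b and a^-1 b^2 lie in the
    intersection of all b^k P b^-k, which b normalises. Hence every element of
    L is in P, P b^-1 or P b^-2, and P n L has index at most 3 in L
    ([near_core_in]). For the other index, some words in a and b turn out to be
    elementary matrices, which generate a group containing every matrix of
    SL_3(O) that is 1 modulo 3 ([congruence_generated]). The proof is a Euclidean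
    descent on the rows: every complex number is at distance at most 1/sqrt 3
    from O, and this bound is just good enough for the powers of lambda that
    the words provide. Two elements of P with the same residues modulo 3 thus
    differ by an element of L ([finite_index_integral]).

    Discreteness. An element of L that is close to 1 is 1. In P this is the
    discreteness of O; in the other two cosets the cube of the corner entry
    would be a ratio of a cube in O to an element whose norm is not a cube
    ([separation]).

    Finite covolume. No formula for the Haar measure is used, only its left
    invariance and its finiteness on compact sets. Through the Gram matrix of
    the rows, reduction theory shows that a Siegel set meets every orbit of P
    ([siegel_reduction]). Cut this set into pieces according to the sizes of
    the quotients of the lengths of the orthogonalised rows. A diagonal matrix
    carries each piece into one fixed compact set. If the coefficients of the
    orthogonalisation are normalised to have real part in [1, 2), then these
    diagonal matrices carry the pieces to disjoint places, because they scale
    the coefficients by different powers of 8. So the measure of the Siegel set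
    is at most that of the compact set ([siegel_measure_finite]). Finitely many
    translates of the Siegel set meet every orbit of L, and a countable cover by
    open sets on which L acts freely selects one point in each orbit
    ([fundamental_domain_of_cover], [covolume_finite]). *)

Set Implicit Arguments.
Unset Strict Implicit.
Unset Printing Implicit Defensive.

Import Order.TTheory GRing.Theory Num.Theory.
Import numFieldTopology.Exports.
Import numFieldNormedType.Exports.

Local Open Scope classical_set_scope.
Local Open Scope ring_scope.

(** * Matrices of size 3 *)

Section Three.
Variable K : comNzRingType.

Lemma sum3E (V : nmodType) (F : 'I_3 -> V) : \sum_i F i = F 0 + F 1 + F 2.
Proof.
rewrite !big_ord_recl big_ord0 addr0 addrA.
by congr (_ + F _ + F _); apply: val_inj.
Qed.

Lemma det3E (M : 'M[K]_3) : \det M =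
  M 0 0 * (M 1 1 * M 2 2 - M 1 2 * M 2 1) - M 0 1 * (M 1 0 * M 2 2 - M 1 2 * M 2 0)
  + M 0 2 * (M 1 0 * M 2 1 - M 1 1 * M 2 0).
Proof.
rewrite (expand_det_row _ 0) !big_ord_recl big_ord0 /cofactor.
rewrite !(expand_det_row _ 0) !big_ord_recl !big_ord0 /cofactor !det_mx11 !mxE /=.
pose f i j := M (inord i) (inord j).
have Mf i j : M i j = f (val i) (val j) by rewrite /f !inord_val.
rewrite !Mf /= /bump /= !addn0 !add1n /=.
by rewrite !expr0 !expr1 !exprS !expr0; ring.
Qed.

Lemma forall3 (P : 'I_3 -> Prop) : P 0 -> P 1 -> P 2 -> forall i, P i.
Proof.
move=> p0 p1 p2 [[|[|[|//]]] hi].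
- by have -> : Ordinal hi = 0 by exact: val_inj.
- by have -> : Ordinal hi = 1 by exact: val_inj.
- by have -> : Ordinal hi = 2 by exact: val_inj.
Qed.
End Three.

(** * Left Haar measures and fundamental domains *)

Section GroupMeasure.
Variables (R : realType) (G : preTopologicalGroupType).
Hypothesis mul_cont : forall g : G, continuous (fun x : G => (g * x)%g).
Local Open Scope group_scope.

Let mb (A : set G) := measurable (A : set (Borel G)).

Lemma translateE (g : G) (A : set G) :
  [set g * x | x in A] = (fun x => g^-1 * x) @^-1` A.
Proof.
apply/seteqP; split=> [_ [x Ax <-]|x /= Ax]; first by rewrite /preimage /= mulKg.
by exists (g^-1 * x) => //; rewrite mulVKg.
Qed.

Lemma open_Borel (A : set G) : open A -> mb A.
Proof. by move=> oA; apply: sub_sigma_algebra. Qed.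

Lemma closed_Borel (A : set G) : closed A -> mb A.
Proof.
move=> cA; rewrite -[A]setCK; apply: measurableC; apply: open_Borel.
exact: closed_openC.
Qed.

Lemma continuous_Borel_preimage (f : G -> G) (A : set G) :
  continuous f -> mb A -> mb (f @^-1` A).
Proof.
move=> cf mA.
have mf : measurable_fun [set: Borel G] (f : Borel G -> Borel G).
  have K := @measurability _ _ (Borel G) (Borel G) setT f (@open G). apply: K => //.
  move=> _ [B oB <-]; rewrite setTI; apply: open_Borel.
  by move/continuousP: cf; apply.
by have := mf measurableT A mA; rewrite setTI.
Qed.

Lemma translate_Borel (g : G) (A : set G) : mb A -> mb [set g * x | x in A].
Proof. by rewrite translateE; apply: continuous_Borel_preimage. Qed.

(** The translates of the pieces are disjoint in K and have the same measures
    as the pieces, so mu K bounds the sum of these measures. *)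
Lemma piecewise_translate_le (mu : {measure set Borel G -> \bar R})
    (S : nat -> set G) (g : nat -> G) (K : set G) :
  left_haar_measure mu -> (forall k, mb (S k)) -> mb K ->
  trivIset setT (fun k => [set g k * x | x in S k]) ->
  (forall k, [set g k * x | x in S k] `<=` K) ->
  (mu (\bigcup_k S k) <= mu K)%E.
Proof.
move=> [muL _ _] mS mK tS SK.
have mgS k : mb [set g k * x | x in S k] by exact: translate_Borel.
have le1 : (mu (\bigcup_k S k) <= \sum_(k <oo) mu (S k))%E.
  apply: measure_sigma_subadditive => //.
  exact: bigcupT_measurable.
apply: le_trans le1 _.
rewrite (eq_eseriesr (g := fun k => mu [set g k * x | x in S k])); last first.
  by move=> k _; rewrite (muL _ _ (mS k)).
rewrite -measure_semi_bigcup //; last exact: bigcupT_measurable.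
apply: le_measure; rewrite ?inE //; first exact: bigcupT_measurable.
by move=> x [k _ /SK].
Qed.

(** Each orbit meets some V n inside S. In the first such V n it has only one
    point, because L acts freely there; the domain consists of these points. *)
Lemma fundamental_domain_of_cover (I : countType) (w : I -> G) (L S : set G)
    (V : nat -> set G) :
  is_subgroup L -> L = range w -> mb S ->
  (forall g, exists2 l, L l & S (l * g)) ->
  (forall n, mb (V n)) -> (forall g, exists n, V n g) ->
  (forall n x l, L l -> V n x -> V n (l * x) -> l = 1) ->
  exists F, [/\ mb F, fundamental_domain L F & F `<=` S].
Proof.
move=> [L1 LM LV] Lw mS LS mV covV freeV.
pose T n := S `&` V n.
pose LT n := \bigcup_i [set w i * x | x in T n].
have mT n : mb (T n) by apply: measurableI; [exact: mS|exact: mV].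
have mLT n : mb (LT n).
  by apply: countable_bigcupT_measurable => [|i]; [exact: countableP|exact: translate_Borel].
pose F := \bigcup_n (T n `\` \bigcup_(k < n) LT k).
have LTP n x : LT n x <-> exists2 l, L l & T n (l * x).
  split=> [[i _ [y Ty <-]]|[l Ll Tx]].
    by exists (w i)^-1; rewrite ?mulKg //; apply: LV; rewrite Lw; exists i.
  have : L l^-1 by exact: LV.
  rewrite Lw => -[i _ wi]; exists i => //; exists (l * x) => //.
  by rewrite wi mulKg.
exists F; split.
- apply: bigcupT_measurable => n; apply: measurableD; first exact: mT.
  by apply: bigcup_measurable => k _; exact: mLT.
- move=> g.
  have ex : exists n, `[< LT n g >].
    have [l Ll Slg] := LS g; have [n Vn] := covV (l * g).
    by exists n; apply/asboolP/LTP; exists l.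
  case: (ex_minnP ex) => n /asboolP /LTP [l Ll Tl] nmin.
  have Fx x : F x -> (exists2 l, L l & g = l * x) ->
      T n x.
    move=> [m _ [Tx nLT]] [l' Ll' gE].
    suff -> : n = m by [].
    apply/eqP; rewrite eqn_leq; apply/andP; split.
      apply: nmin; apply/asboolP/LTP; exists l'^-1; first exact: LV.
      by rewrite gE mulKg.
    rewrite leqNgt; apply/negP => nm; apply: nLT; exists n => //; apply/LTP.
    exists (l * l'); first exact: LM.
    by rewrite -mulgA -gE.
  exists (l * g); split.
    split; last by exists l^-1; [exact: LV|rewrite mulKg].
    exists n => //; split => // -[k /= kn] /LTP[l' Ll' Tk].
    have : (n <= k)%N; last by rewrite leqNgt kn.
    apply: nmin; apply/asboolP/LTP; exists (l' * l); first exact: LM.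
    by rewrite -mulgA.
  move=> x [Fx1 hx]; have [_ Vx] := Fx x Fx1 hx.
  case: hx => l' Ll' gE; case: Tl => _ Vl.
  have : l * l' = 1.
    by apply: (freeV n x) => //; [exact: LM|rewrite -mulgA -gE].
  by rewrite gE mulgA => ->; rewrite mul1g.
- by move=> x [n _ [[]]].
Qed.

End GroupMeasure.

(** * The topology of SL_3(C) and PSL_3(C) *)

Section ComplexCoordinates.
Variable R : realType.
Local Notation C := (R[i]).
Implicit Types z w : C.

(** Estimates are stated for squared moduli: they are polynomial in the
    coordinates and take values in the totally ordered field R. *)
Definition nsq (z : C) : R := complex.Re z ^+ 2 + complex.Im z ^+ 2.

Lemma nsqE z : (nsq z)%:C%C = z * conjc z.
Proof. by case: z => a b; rewrite /nsq /=; simpc; congr (_ +i* _)%C; ring. Qed.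

Lemma nsq_ge0 z : 0 <= nsq z.
Proof. by rewrite addr_ge0 ?sqr_ge0. Qed.

Lemma nsq_eq0 z : (nsq z == 0) = (z == 0).
Proof.
by case: z => a b; rewrite /nsq paddr_eq0 ?sqr_ge0 // !sqrf_eq0 eq_complex.
Qed.

Lemma nsqM z w : nsq (z * w) = nsq z * nsq w.
Proof. by case: z w => a b [c d]; rewrite /nsq /=; ring. Qed.

Lemma nsqN z : nsq (- z) = nsq z.
Proof. by case: z => a b; rewrite /nsq /=; ring. Qed.

Lemma norm_lt_nsq z (e : R) : 0 < e -> (`|z| < e%:C%C) = (nsq z < e ^+ 2).
Proof.
move=> e0; rewrite normc_def ltcR -[X in _ < X](@ger0_norm _ e) ?ltW //.
by rewrite -sqrtr_sqr ltr_sqrt ?exprn_gt0.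
Qed.

Lemma Re_cont : continuous (@complex.Re R : C -> R).
Proof.
move=> z A /nbhs_ballP[e /= e0 eA].
have e0' : 0 < e%:C%C :> C by rewrite ltcR.
apply: (@filterS _ (nbhs z) (nbhs_filter z) _ _ _ (nbhsx_ballx z e%:C%C e0')).
move=> w /= h; apply: eA; rewrite /ball /=.
rewrite -ltcR; apply: le_lt_trans h; apply: le_trans (normc_ge_Re _).
by case: w => a b; case: z => c d.
Qed.

Lemma Im_cont : continuous (@complex.Im R : C -> R).
Proof.
move=> z A /nbhs_ballP[e /= e0 eA].
have e0' : 0 < e%:C%C :> C by rewrite ltcR.
apply: (@filterS _ (nbhs z) (nbhs_filter z) _ _ _ (nbhsx_ballx z e%:C%C e0')).
move=> w /= h; apply: eA; rewrite /ball /=.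
have <- : - complex.Re ((z - w) * 'i%C) = complex.Im z - complex.Im w.
  by rewrite ReiNIm opprK; case: (w) => a b; case: (z) => c d.
rewrite -ltcR normrN; apply: le_lt_trans h; apply: le_trans (normc_ge_Re _) _.
by rewrite normrM [X in _ * X]normc_def /= expr0n add0r expr1n sqrtr1 mulr1.
Qed.

(** Continuity of the real and imaginary parts: the arguments about the
    topology of R[i] reduce to arguments in R. *)
Definition ccont (T : topologicalType) (F : T -> C) :=
  continuous (fun t => complex.Re (F t)) /\ continuous (fun t => complex.Im (F t)).

Section ccont.
Variable T : topologicalType.
Implicit Types F G : T -> C.
Lemma ccont_cst z : ccont (fun=> z : C) (T := T).
Proof. by split; apply: cst_continuous. Qed.

Lemma ccontJ F : ccont F -> ccont (fun t => conjc (F t)).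
Proof.
have E t : complex.Re (conjc (F t)) = complex.Re (F t) by case: (F t).
have E' t : complex.Im (conjc (F t)) = - complex.Im (F t) by case: (F t).
move=> [r i]; split; rewrite (funext E, funext E') //.
by move=> t; apply: cvgN; exact: i.
Qed.

Lemma ccontD F G : ccont F -> ccont G -> ccont (fun t => F t + G t).
Proof.
have E t : complex.Re (F t + G t) = complex.Re (F t) + complex.Re (G t).
  by case: (F t) (G t) => a b [].
have E' t : complex.Im (F t + G t) = complex.Im (F t) + complex.Im (G t).
  by case: (F t) (G t) => a b [].
move=> [r i] [r' i']; split; [rewrite (funext E)|rewrite (funext E')] => t.
  by apply: cvgD; [exact: r|exact: r'].
by apply: cvgD; [exact: i|exact: i'].
Qed.

Lemma ccontM F G : ccont F -> ccont G -> ccont (fun t => F t * G t).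
Proof.
have E t : complex.Re (F t * G t) = complex.Re (F t) * complex.Re (G t)
  - complex.Im (F t) * complex.Im (G t) by case: (F t) (G t) => a b [].
have E' t : complex.Im (F t * G t) = complex.Re (F t) * complex.Im (G t)
  + complex.Im (F t) * complex.Re (G t) by case: (F t) (G t) => a b [].
move=> [r i] [r' i']; split; [rewrite (funext E)|rewrite (funext E')] => t.
  by apply: cvgB; apply: cvgM; [exact: r|exact: r'|exact: i|exact: i'].
by apply: cvgD; apply: cvgM; [exact: r|exact: i'|exact: i|exact: r'].
Qed.

Lemma ccontN F : ccont F -> ccont (fun t => - F t).
Proof.
move=> cF; have := ccontM (ccont_cst (-1)) cF.
by under eq_fun do rewrite mulN1r.
Qed.

Lemma ccont_sum n (F : 'I_n -> T -> C) :
  (forall i, ccont (F i)) -> ccont (fun t => \sum_i F i t).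
Proof.
elim: n F => [|n IH] F cF.
  by under eq_fun do rewrite big_ord0; exact: ccont_cst.
by under eq_fun do rewrite big_ord_recl; apply: ccontD => //; exact: IH.
Qed.
End ccont.

Lemma entry_cont (i j : 'I_3) : ccont (fun M : SL R 3 => SLval M i j).
Proof.
have c : continuous (fun M : SL R 3 => SLval M i j : C).
  move=> M.
  apply: (@continuous_comp (SL R 3) 'M[C]_3 C (@SLval R 3) (fun A : 'M[C]_3 => A i j)).
    exact: initial_continuous.
  exact: coord_continuous.
split=> M.
  exact: (@continuous_comp _ C R _ _ _ (c M) (@Re_cont _)).
exact: (@continuous_comp _ C R _ _ _ (c M) (@Im_cont _)).
Qed.

Definition SLball (M : 'M[C]_3) (e : R) : set (SL R 3) :=
  [set N | forall i j, nsq (SLval N i j - M i j) < e].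

Lemma nbhs_SLball (M : SL R 3) (A : set (SL R 3)) :
  nbhs M A -> exists2 e : R, 0 < e & SLball (SLval M) e `<=` A.
Proof.
move=> [B [[W oW <-] WM] WA].
have : nbhs (SLval M : 'M[C]_3) W by exact: open_nbhs_nbhs.
move=> /nbhs_ballP [e /= e0 eW].
have [r r0 re] : exists2 r : R, 0 < r & e = r%:C%C.
  move: e0; case: (e) => a b; rewrite ltcE /= => /andP[/eqP -> a0].
  by exists a.
exists (r ^+ 2); first by rewrite exprn_gt0.
move=> N NM; apply: WA; apply: eW; split=> //.
move=> i j; rewrite /ball /= re norm_lt_nsq // -nsqN opprB.
exact: NM.
Qed.

Lemma nsq_cont (T : topologicalType) (F : T -> C) :
  ccont F -> continuous (fun t => nsq (F t)).
Proof.
move=> [r i] t; apply: cvgD; rewrite expr2; under eq_fun do rewrite expr2;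
  by apply: cvgM; (exact: r || exact: i).
Qed.

Lemma SL_continuous (T : topologicalType) (f : T -> SL R 3) :
  (forall i j, ccont (fun t => SLval (f t) i j)) -> continuous f.
Proof.
move=> cf t A /nbhs_SLball[e e0 eA].
have : \forall t' \near t, forall ij : 'I_3 * 'I_3,
    nsq (SLval (f t') ij.1 ij.2 - SLval (f t) ij.1 ij.2) < e.
  apply: filter_forall => -[i j] /=.
  have c := nsq_cont (ccontD (cf i j) (ccont_cst T (- SLval (f t) i j))).
  have : nbhs (nsq (SLval (f t) i j - SLval (f t) i j)) [set x : R | x < e].
    apply: open_nbhs_nbhs; split; first exact: open_lt.
    by rewrite /= subrr /nsq /= expr0n addr0.
  by move=> /(c t).
apply: filterS => t' H; apply: eA => i j; exact: (H (i, j)).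
Qed.

Lemma open_SLball M e : open (SLball M e).
Proof.
rewrite openE => N MN.
have : \forall N' \near nbhs N, forall ij : 'I_3 * 'I_3,
    nsq (SLval N' ij.1 ij.2 - M ij.1 ij.2) < e.
  apply: filter_forall => -[i j] /=.
  have c := nsq_cont (ccontD (entry_cont i j) (ccont_cst _ (- M i j))).
  have : nbhs (nsq (SLval N i j - M i j)) [set x : R | x < e].
    by apply: open_nbhs_nbhs; split; [exact: open_lt|exact: MN].
  by move=> /(c N).
by apply: filterS => N' H i j; exact: (H (i, j)).
Qed.

Lemma SL_mul_cont (M : SL R 3) : continuous (SL_mul M).
Proof.
apply: SL_continuous => i j; under eq_fun do rewrite /= mxE.
apply: ccont_sum => k; apply: ccontM; first exact: ccont_cst.
exact: entry_cont.
Qed.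

Lemma PSL_class_cont : continuous (@PSL_class R 3).
Proof. exact: pi_continuous. Qed.

Lemma PSL_from_cont (Z : topologicalType) (f : PSL R 3 -> Z) :
  continuous (fun M => f (PSL_class M)) -> continuous f.
Proof. by move=> cf; apply/quotient_continuous. Qed.

Lemma PSL_mul_cont (g : PSL R 3) : continuous (fun x : PSL R 3 => (g * x)%g).
Proof.
rewrite -(PSL_reprK g); apply: PSL_from_cont.
rewrite (_ : (fun M => _) = @PSL_class R 3 \o SL_mul (PSL_repr g)); last first.
  by apply/funext => M /=; exact: PSL_mulE.
move=> M; apply: continuous_comp; first exact: SL_mul_cont.
exact: PSL_class_cont.
Qed.

Lemma SL3_scalar (c : C) (M N : SL R 3) : SLval M = c *: SLval N -> c ^+ 3 = 1.
Proof.
move=> E; have := eqP (SL_det M).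
by rewrite E detZ (eqP (SL_det N)) mulr1.
Qed.

(** The saturation of A is the union of its translates by the scalar matrices
    of determinant 1. *)
Lemma PSL_class_open (A : set (SL R 3)) : open A -> open (@PSL_class R 3 @` A).
Proof.
move=> oA; rewrite /open /= /quotient_open.
pose cm (c : C) (e : c ^+ 3 = 1) : SL R 3 :=
  @MkSL R 3 c%:M (introT eqP (etrans (det_scalar _ c) e)).
rewrite (_ : _ @^-1` _ = \bigcup_(ce : {c : C | c ^+ 3 = 1})
    (SL_mul (cm _ (proj2_sig ce)) @^-1` A)); last first.
  apply/seteqP; split=> N /=.
    move=> [M AM MN]; have [c E] := (PSL_classP M N).2 MN.
    exists (exist _ c (SL3_scalar E)) => //=.
    rewrite /preimage /= (_ : SL_mul _ _ = M) //; apply: val_inj => /=.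
    by rewrite mul_scalar_mx E.
  move=> [[c e] _ /= AM]; exists (SL_mul (cm c e) N); first exact: AM.
  have H : PSL_class (SL_mul (cm c e) N) = PSL_class N.
    by apply/PSL_classP; exists c; rewrite /= mul_scalar_mx.
  exact: H.
apply: bigcup_open => ce _.
by move/continuousP: (@SL_mul_cont (cm _ (proj2_sig ce))); apply.
Qed.

End ComplexCoordinates.

(** * Gram matrices *)

Section Gram.
Variable R : realType.
Local Notation C := (R[i]).

Definition conjmx n (M : 'M[C]_n) : 'M[C]_n := (map_mx (@conjc R) M)^T.
Definition gram n (M : 'M[C]_n) : 'M[C]_n := M *m conjmx M.

Lemma conjmxM n (M N : 'M[C]_n) : conjmx (M *m N) = conjmx N *m conjmx M.
Proof. by rewrite /conjmx map_mxM trmx_mul. Qed.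

Lemma gramE n (M : 'M[C]_n) i j : gram M i j = \sum_k M i k * conjc (M j k).
Proof. by rewrite mxE; apply: eq_bigr => k _; rewrite !mxE. Qed.

Lemma gramM n (M N : 'M[C]_n) : gram (M *m N) = M *m gram N *m conjmx M.
Proof. by rewrite /gram conjmxM !mulmxA. Qed.

Lemma nsq_root1 (c : C) n : c ^+ n.+1 = 1 -> nsq c = 1.
Proof.
move=> c1; have : nsq c ^+ n.+1 = 1.
  have nsqX k : nsq c ^+ k = nsq (c ^+ k).
    elim: k => [|k IH]; last by rewrite !exprS IH nsqM.
    by rewrite /nsq /= expr0n addr0 expr1n.
  by rewrite nsqX c1 /nsq /= expr0n addr0 expr1n.
by move=> /eqP; rewrite pexpr_eq1 ?nsq_ge0 // => /eqP.
Qed.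

(** A representative is determined up to a cube root of unity, which has
    modulus 1, so its Gram matrix depends on its class only. Reduction theory
    and measure estimates see an element of PSL_3(C) through this matrix. *)
Definition PSLgram (x : PSL R 3) : 'M[C]_3 := gram (SLval (PSL_repr x)).

Lemma PSLgram_class (M : SL R 3) : PSLgram (PSL_class M) = gram (SLval M).
Proof.
have [c E] := (PSL_classP _ _).2 (PSL_reprK (PSL_class M)).
rewrite /PSLgram E /gram.
rewrite (_ : conjmx _ = conjc c *: conjmx (SLval M)); last first.
  by apply/matrixP => i j; rewrite !mxE rmorphM.
rewrite -scalemxAl -scalemxAr scalerA -nsqE.
by rewrite (nsq_root1 (SL3_scalar E)) scale1r.
Qed.

Lemma PSLgramM (M : SL R 3) (x : PSL R 3) :
  PSLgram (PSL_class M * x)%g = SLval M *m PSLgram x *m conjmx (SLval M).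
Proof.
rewrite -(PSL_reprK x) [(_ * _)%g]PSL_mulE !PSLgram_class.
exact: gramM.
Qed.

Lemma PSLgram_cont i j : ccont (fun x : PSL R 3 => PSLgram x i j).
Proof.
have c : ccont (fun M : SL R 3 => gram (SLval M) i j).
  under eq_fun do rewrite gramE.
  apply: ccont_sum => k; apply: ccontM; first exact: entry_cont.
  by apply: ccontJ; exact: entry_cont.
case: c => cr ci; split; apply: PSL_from_cont; under eq_fun do rewrite PSLgram_class.
  exact: cr.
exact: ci.
Qed.

Lemma ccont_det3 (T : topologicalType) (F : T -> 'M[C]_3) :
  (forall i j, ccont (fun t => F t i j)) -> ccont (fun t => \det (F t)).
Proof.
move=> cF; under eq_fun do rewrite det3E.
have cminor i j k l m n : ccont (fun t =>
    F t i j * (F t k l * F t m n - F t k n * F t m l)).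
  apply: (ccontM (cF i j)); apply: ccontD; first exact: (ccontM (cF _ _) (cF _ _)).
  exact: (ccontN (ccontM (cF _ _) (cF _ _))).
exact: (ccontD (ccontD (cminor _ _ _ _ _ _) (ccontN (cminor _ _ _ _ _ _)))
  (cminor _ _ _ _ _ _)).
Qed.

Lemma closed_le_cont (T : topologicalType) (f g : T -> R) :
  continuous f -> continuous g -> closed [set x | f x <= g x].
Proof.
move=> cf cg.
rewrite (_ : [set x | _] = (fun x => g x - f x) @^-1` [set y | 0 <= y]); last first.
  by apply/seteqP; split=> x /=; rewrite subr_ge0.
apply: preimage_closed; last exact: closed_ge.
by move=> x _; apply: cvgB; [exact: cg|exact: cf].
Qed.

Lemma closed_eq_cont (T : topologicalType) (f : T -> C) (z : C) :
  ccont f -> closed [set x | f x = z].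
Proof.
move=> [fr fi].
rewrite (_ : [set x | _] = (fun x => complex.Re (f x)) @^-1` [set complex.Re z]
   `&` (fun x => complex.Im (f x)) @^-1` [set complex.Im z]); last first.
  apply/seteqP; split=> x /=; first by move=> ->.
  by case: (f x) z => a b [c d] /= [-> ->].
apply: closedI; apply: preimage_closed; do ?exact: closed_eq.
  by move=> x _; exact: fr.
by move=> x _; exact: fi.
Qed.

Section Compactness.
Let toM (v : 'rV[R]_(3 * 3 + 3 * 3)) : 'M[C]_3 :=
  \matrix_(i, j) (vec_mx (lsubmx v) i j +i* vec_mx (rsubmx v) i j)%C.

Let ofM (M : 'M[C]_3) : 'rV[R]_(3 * 3 + 3 * 3) :=
  row_mx (mxvec (map_mx (@complex.Re R) M)) (mxvec (map_mx (@complex.Im R) M)).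

Let ofMK M : toM (ofM M) = M.
Proof.
apply/matrixP => i j; rewrite /toM /ofM row_mxKl row_mxKr !mxvecK !mxE.
by case: (M i j).
Qed.

Let toM_cont i j : ccont (fun v => toM v i j).
Proof.
split.
  rewrite (_ : (fun _ => _) = (fun v : 'rV[R]_(3 * 3 + 3 * 3) =>
     v ord0 (lshift (3 * 3) (mxvec_index i j)))); last first.
    by apply/funext => v; rewrite !mxE /=.
  exact: coord_continuous.
rewrite (_ : (fun _ => _) = (fun v : 'rV[R]_(3 * 3 + 3 * 3) =>
   v ord0 (rshift (3 * 3) (mxvec_index i j)))); last first.
  by apply/funext => v; rewrite !mxE /=.
exact: coord_continuous.
Qed.

(** The diagonal of the Gram matrix bounds all entries, so the set is the
    image of a closed and bounded subset of R^18. *)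
Lemma compact_gram_le (B : R) :
  compact [set x : PSL R 3 | forall i, complex.Re (PSLgram x i i) <= B].
Proof.
pose A := [set v | \det (toM v) = 1 /\
                   forall i, complex.Re (gram (toM v) i i) <= B].
have cgram i : ccont (fun v => gram (toM v) i i).
  under eq_fun do rewrite gramE.
  by apply: ccont_sum => k; apply: ccontM; [|apply: ccontJ]; exact: toM_cont.
have cA : closed A.
  rewrite (_ : A = [set v | \det (toM v) = 1] `&`
     \bigcap_(i in [set: 'I_3]) [set v | complex.Re (gram (toM v) i i) <= B]); last first.
    apply/seteqP; split=> v [? H]; split=> // i; last exact: H.
    by move=> _; exact: H.
  apply: closedI.
    by apply: closed_eq_cont; exact: ccont_det3.
  apply: closed_bigI => i _; apply: closed_le_cont; first exact: (cgram i).1.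
  exact: cst_continuous.
have entry_le v i j : A v -> nsq (toM v i j) <= B.
  move=> [_ /(_ i)]; apply: le_trans; rewrite gramE.
  rewrite (eq_bigr (fun k => (nsq (toM v i k))%:C%C)); last first.
    by move=> k _; rewrite nsqE.
  rewrite -rmorph_sum /= (bigD1 j) //= lerDl sumr_ge0 // => k _.
  exact: nsq_ge0.
have bA : bounded_set A.
  exists (B + 1); split; first exact: num_real.
  move=> x Bx v Av. rewrite /= [leLHS](mx_normrE v).
  have sq_le (y : R) : y ^+ 2 <= B -> `|y| <= x.
    move=> yB; have B0 : 0 <= B by exact: le_trans (sqr_ge0 y) yB.
    rewrite -(ler_pXn2r (n := 2)) ?nnegrE ?normr_ge0 //; last by lra.
    by rewrite real_normK ?num_real //; nra.
  apply/bigmax_leP; split; first by have := entry_le v 0 0 Av; have := nsq_ge0 (toM v 0 0); lra.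
  move=> [i k] _ /=; apply: sq_le; rewrite (ord1 i).
  rewrite -[v]hsubmxK; case: (splitP k) => k' kk'.
    have -> : k = lshift (3 * 3) k' by apply: val_inj.
    rewrite row_mxEl; case: (mxvec_indexP k') => a b.
    apply: le_trans (entry_le v a b Av).
    by rewrite /nsq !mxE /= lerDl sqr_ge0.
  have -> : k = rshift (3 * 3) k' by apply: val_inj.
  rewrite row_mxEr; case: (mxvec_indexP k') => a b.
  apply: le_trans (entry_le v a b Av).
  by rewrite /nsq !mxE /= lerDr sqr_ge0.
have kA : compact A by exact: bounded_closed_compact.
pose psi v : SL R 3 := insubd (SL_one R 3) (toM v).
have psiE v : \det (toM v) = 1 -> SLval (psi v) = toM v.
  by move=> d; rewrite /psi val_insubd d eqxx.
have cpsi : {within A, continuous psi}.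
  apply: SL_continuous => i j; have [tr ti] := toM_cont i j.
  split.
    apply: (@subspace_eq_continuous _ A _ (fun v => complex.Re (toM v i j))).
      by move=> v /set_mem [d _] /=; rewrite psiE.
    exact: continuous_subspaceT.
  apply: (@subspace_eq_continuous _ A _ (fun v => complex.Im (toM v i j))).
    by move=> v /set_mem [d _] /=; rewrite psiE.
  exact: continuous_subspaceT.
have := continuous_compact (continuous_subspaceT (@PSL_class_cont R)) (continuous_compact cpsi kA).
congr compact; apply/seteqP; split=> [_ [_ [v [d vB] <-] <-] i|x xB].
  by rewrite PSLgram_class psiE.
have d : \det (toM (ofM (SLval (PSL_repr x)))) = 1 by rewrite ofMK; apply/eqP/SL_det.
exists (psi (ofM (SLval (PSL_repr x)))).
  by exists (ofM (SLval (PSL_repr x))) => //; split=> // i; rewrite ofMK; exact: xB.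
rewrite -[RHS]PSL_reprK; congr PSL_class; apply: val_inj.
by rewrite /= psiE // ofMK.
Qed.
End Compactness.
End Gram.

(** * Eisenstein integers *)

(** In the lattice basis 1, omega the squared distances are the values of s^2
    - s t + t^2. For a point of an equilateral triangle of side 1, the mean
    of the squared distances to the vertices, weighted by the barycentric
    coordinates of the point, is at most 1/3. *)
Lemma hexagon_covering (F : realFieldType) (s t : F) :
  0 <= s < 1 -> 0 <= t < 1 ->
  (s ^+ 2 - s * t + t ^+ 2 <= 1 / 3) ||
  [|| (s - 1) ^+ 2 - (s - 1) * (t - 1) + (t - 1) ^+ 2 <= 1 / 3,
      (s - 1) ^+ 2 - (s - 1) * t + t ^+ 2 <= 1 / 3 |
      s ^+ 2 - s * (t - 1) + (t - 1) ^+ 2 <= 1 / 3].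
Proof.
move=> /andP[s0 s1] /andP[t0 t1].
set d00 := _ + t ^+ 2; set d11 := _ + (t - 1) ^+ 2; set d10 := _ + t ^+ 2.
set d01 := _ + (t - 1) ^+ 2.
have bary (u v w x y z : F) : 0 <= u -> 0 <= v -> 0 <= w -> u + v + w = 1 ->
    u * x + v * y + w * z <= 1 / 3 -> [|| x <= 1 / 3, y <= 1 / 3 | z <= 1 / 3].
  move=> u0 v0 w0 e h; rewrite !leNgt -!negb_and; apply/negP => /and3P[hx hy hz].
  have zero (c r : F) : 0 <= c -> 1 / 3 < r -> c * (r - 1 / 3) <= 0 -> c = 0.
    by move=> c0 r3; rewrite pmulr_lle0 ?subr_gt0 // => c0'; apply/le_anti/andP.
  have hu : 0 <= u * (x - 1 / 3) by rewrite mulr_ge0 // subr_ge0 ltW.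
  have hv : 0 <= v * (y - 1 / 3) by rewrite mulr_ge0 // subr_ge0 ltW.
  have hw : 0 <= w * (z - 1 / 3) by rewrite mulr_ge0 // subr_ge0 ltW.
  have hs : u * (x - 1 / 3) + v * (y - 1 / 3) + w * (z - 1 / 3) <= 0.
    rewrite (_ : _ + _ = u * x + v * y + w * z - (u + v + w) / 3); last by field.
    by rewrite e; lra.
  have u00 : u = 0 by apply: zero hx _ => //; lra.
  have v00 : v = 0 by apply: zero hy _ => //; lra.
  have w00 : w = 0 by apply: zero hz _ => //; lra.
  by move: e => /eqP; rewrite u00 v00 w00 !addr0 eq_sym oner_eq0.
(* The diagonal t = s cuts the cell into two equilateral triangles. *)
have [ts|/ltW st] := leP t s.
  suff : [|| d00 <= 1 / 3, d10 <= 1 / 3 | d11 <= 1 / 3] by case/or3P => ->; rewrite ?orbT.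
  apply: (@bary (1 - s) (s - t) t); [lra|lra|lra|ring|].
  rewrite /d00 /d10 /d11.
  have := sqr_ge0 (s - 2 / 3 - (t - 1 / 3) / 2); have := sqr_ge0 (t - 1 / 3); nra.
suff : [|| d00 <= 1 / 3, d01 <= 1 / 3 | d11 <= 1 / 3] by case/or3P => ->; rewrite ?orbT.
apply: (@bary (1 - t) (t - s) s); [lra|lra|lra|ring|].
rewrite /d00 /d01 /d11.
have := sqr_ge0 (t - 2 / 3 - (s - 1 / 3) / 2); have := sqr_ge0 (s - 1 / 3); nra.
Qed.

Section Eisenstein.
Variables (R : realType) (omega : R[i]).
Hypothesis homega : 3.-primitive_root omega.
Local Notation C := (R[i]).
Local Notation Re := (@complex.Re R).
Local Notation Im := (@complex.Im R).
Local Notation O := (Zadjoin omega).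
Implicit Types x y z : C.

Lemma omega3 : omega ^+ 3 = 1. Proof. exact: prim_expr_order. Qed.

Lemma omega_neq1 : omega != 1.
Proof. by rewrite -[omega]expr1 -(prim_order_dvd homega). Qed.

Lemma omega_sq : omega ^+ 2 = - omega - 1.
Proof.
have : (omega - 1) * (omega ^+ 2 + omega + 1) = 0.
  have -> : (omega - 1) * (omega ^+ 2 + omega + 1) = omega ^+ 3 - 1 by ring.
  by rewrite omega3 subrr.
move=> /eqP; rewrite mulf_eq0 subr_eq0 (negPf omega_neq1) /= => /eqP e.
by apply/eqP; rewrite -subr_eq0 -e; apply/eqP; ring.
Qed.

Lemma omega_coord : Re omega = - (1 / 2) /\ Im omega ^+ 2 = 3 / 4.
Proof.
move: omega_sq; case: omega => a b /=; rewrite expr2; simpc => -[e1 e2].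
have /eqP : b * (2 * a + 1) = 0 by lra.
rewrite mulf_eq0 => /orP[/eqP b0|/eqP a2]; last by split; [lra|nra].
by exfalso; move: e1; rewrite b0; nra.
Qed.

Lemma O_basisP z : O z <-> exists a b : int, z = a%:~R + b%:~R * omega.
Proof.
split=> [[p ->]|[a [b ->]]].
  elim/poly_ind: p => [|p c [a [b IH]]].
    by exists 0, 0; rewrite rmorph0 horner0 mul0r addr0.
  exists (c - b), (a - b); rewrite rmorphD rmorphM /= map_polyX map_polyC.
  rewrite hornerD hornerMX hornerC IH /= !intrB mulrDl -mulrA -expr2 omega_sq.
  by ring.
exists (a%:P + b%:P * 'X); rewrite rmorphD rmorphM /= map_polyX !map_polyC /=.
by rewrite hornerD hornerMX !hornerC.
Qed.

Lemma O_int (a : int) : O a%:~R.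
Proof. by apply/O_basisP; exists a, 0; rewrite mul0r addr0. Qed.
Lemma O_omega : O omega.
Proof. by apply/O_basisP; exists 0, 1; rewrite add0r mul1r. Qed.
Lemma O_nat (n : nat) : O n%:R.
Proof. by have := O_int (Posz n); rewrite -pmulrn. Qed.
Lemma O_0 : O 0. Proof. exact: (O_int 0). Qed.
Lemma O_1 : O 1. Proof. exact: (O_int 1). Qed.

Lemma O_add x y : O x -> O y -> O (x + y).
Proof. by move=> [p ->] [q ->]; exists (p + q); rewrite rmorphD hornerD. Qed.
Lemma O_mul x y : O x -> O y -> O (x * y).
Proof. by move=> [p ->] [q ->]; exists (p * q); rewrite rmorphM hornerM. Qed.
Lemma O_opp x : O x -> O (- x).
Proof. by move=> [p ->]; exists (- p); rewrite rmorphN hornerN. Qed.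
Lemma O_sub x y : O x -> O y -> O (x - y).
Proof. by move=> Ox Oy; apply: O_add => //; exact: O_opp. Qed.
Lemma O_sum n (F : 'I_n -> C) : (forall i, O (F i)) -> O (\sum_i F i).
Proof.
by move=> OF; elim/big_ind: _ => [|x y|i _]; [exact: O_0|exact: O_add|exact: OF].
Qed.

Lemma nsq_O (a b : int) :
  nsq (a%:~R + b%:~R * omega) = (a ^+ 2 - a * b + b ^+ 2)%:~R.
Proof.
have Rez (c : int) : Re c%:~R = c%:~R /\ Im c%:~R = 0.
  by rewrite -(rmorph_int (real_complex R)).
have [r s] := omega_coord; case: (Rez a) (Rez b) => ra ia [rb ib].
rewrite /nsq; case: omega r s => u v /= -> s.
case: (a%:~R : C) ra ia => ? ? /= -> ->; case: (b%:~R : C) rb ib => ? ? /= -> ->.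
by rewrite intrD intrB !intrM; nra.
Qed.

Lemma O_nsq z : O z -> exists n : nat, nsq z = n%:R.
Proof.
move=> /O_basisP[a [b ->]]; exists (absz (a ^+ 2 - a * b + b ^+ 2)).
rewrite nsq_O natr_absz ger0_norm //.
have : 0 <= 4 * (a ^+ 2 - a * b + b ^+ 2).
  rewrite (_ : 4 * _ = (2 * a - b) ^+ 2 + 3 * b ^+ 2); last by ring.
  by apply: addr_ge0; [|apply: mulr_ge0 => //]; exact: sqr_ge0.
by rewrite pmulr_rge0.
Qed.

Lemma O_nsq_ge1 z : O z -> z != 0 -> 1 <= nsq z.
Proof.
move=> Oz z0; have [n nz] := O_nsq Oz.
by move: z0; rewrite -nsq_eq0 nz pnatr_eq0 -lt0n ler1n.
Qed.

Lemma O_coord z : exists a b : R, z = a%:C%C + b%:C%C * omega.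
Proof.
have [r s] := omega_coord; case: z => x y; case: omega r s => u v /= r s.
have v0 : v != 0 by apply/eqP => v0; move: s; rewrite v0 expr0n /=; lra.
exists (x - y / v * u), (y / v); simpc.
by congr (_ +i* _)%C; [ring|field].
Qed.

Lemma nsq_coord (a b : R) : nsq (a%:C%C + b%:C%C * omega) = a ^+ 2 - a * b + b ^+ 2.
Proof. by have [r s] := omega_coord; rewrite /nsq; case: omega r s => u v /= -> s; nra. Qed.

Lemma O_round z : exists2 q, O q & nsq (z - q) <= 1 / 3.
Proof.
have [a [b ->]] := O_coord z.
pose m := Num.floor a; pose n := Num.floor b.
have /andP[m1 m2] := floor_itv a.
have /andP[n1 n2] := floor_itv b.
rewrite -/m in m1 m2; rewrite -/n in n1 n2.
have H (k l : int) :
    (a - k%:~R) ^+ 2 - (a - k%:~R) * (b - l%:~R) + (b - l%:~R) ^+ 2 <= 1 / 3 ->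
    exists2 q, O q & nsq (a%:C%C + b%:C%C * omega - q) <= 1 / 3.
  move=> h; exists (k%:~R + l%:~R * omega); first by apply/O_basisP; exists k, l.
  rewrite (_ : _ - _ = (a - k%:~R)%:C%C + (b - l%:~R)%:C%C * omega).
    by rewrite nsq_coord.
  by rewrite !rmorphB /= !rmorph_int; ring.
have m3 : a < m%:~R + 1 by rewrite -(intrD _ m 1).
have n3 : b < n%:~R + 1 by rewrite -(intrD _ n 1).
have Em : (m + 1)%:~R = m%:~R + 1 :> R by rewrite intrD.
have En : (n + 1)%:~R = n%:~R + 1 :> R by rewrite intrD.
move: (H m n) (H (m + 1) (n + 1)) (H (m + 1) n) (H m (n + 1)).
rewrite Em En => h1 h2 h3 h4.
set s := a - m%:~R in h1 h2 h3 h4 *; set t := b - n%:~R in h1 h2 h3 h4 *.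
have s0 : 0 <= s < 1 by rewrite /s; apply/andP; split; lra.
have t0 : 0 <= t < 1 by rewrite /t; apply/andP; split; lra.
have E (c d : R) : a - (m%:~R + 1) = s - 1 /\ b - (n%:~R + 1) = t - 1.
  by rewrite /s /t; split; ring.
have [Ea Eb] := E 0 0; rewrite Ea Eb in h2 h3 h4.
have [|] := orP (hexagon_covering s0 t0); first exact: h1.
by move=> /or3P[]; [exact: h2|exact: h3|exact: h4].
Qed.


Definition lam : C := 1 - omega.

Lemma lam_sq : lam ^+ 2 = - 3 * omega.
Proof. by rewrite /lam sqrrB expr1n mul1r omega_sq; ring. Qed.

Lemma O_lam : O lam. Proof. by apply: O_sub; [exact: O_1|exact: O_omega]. Qed.

Lemma O_exp x n : O x -> O (x ^+ n).
Proof.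
move=> Ox; elim: n => [|n IH]; first by rewrite expr0; exact: O_1.
by rewrite exprS; exact: O_mul.
Qed.

Lemma nsq_exp x n : nsq (x ^+ n) = nsq x ^+ n.
Proof.
elim: n => [|n IH]; last by rewrite !exprS nsqM IH.
by rewrite /nsq /= expr0n addr0 expr1n.
Qed.

Lemma nsq_lam : nsq lam = 3.
Proof.
rewrite (_ : lam = 1%:~R + (-1)%:~R * omega); last by rewrite /lam mulN1r.
by rewrite nsq_O.
Qed.

Lemma lam_neq0 : lam != 0.
Proof. by rewrite -nsq_eq0 nsq_lam pnatr_eq0. Qed.

(** Modulo 3 the left side is 1 and the right side is 0. In the descent below
    this excludes ties, where a reduction step would not lower the norm. *)
Lemma nsq_unit_mod w y : O w -> O y -> nsq (1 + lam ^+ 2 * w) != 3 * nsq y.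
Proof.
rewrite lam_sq => Ow Oy.
have /O_basisP[a [b E]] : O (omega * w) by apply: O_mul => //; exact: O_omega.
have [n ->] := O_nsq Oy.
rewrite (_ : 1 + _ = (1 - 3 * a)%:~R + (- 3 * b)%:~R * omega); last first.
  by rewrite -mulrA E intrB !intrM intrN; ring.
rewrite nsq_O -(natrM R 3) -[(3 * n)%:R]mulrz_nat eqr_int.
by apply/eqP; lia.
Qed.

(** The real part is taken in [1, 2), not around 0: in the Siegel set it then
    cannot vanish, and scaling it by different powers of 8 gives disjoint
    intervals. *)
Lemma O_round_Re z : exists2 q, O q & (1 <= Re (z + q) < 2) && (nsq (z + q) <= 5).
Proof.
have [q Oq hq] := O_round z.
pose m := Num.floor (Re (z - q)).
have /andP[m1 m2] := floor_itv (Re (z - q)); rewrite -/m intrD in m1 m2.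
exists ((1 - m)%:~R - q); first by apply: O_sub => //; exact: O_int.
have -> : z + ((1 - m)%:~R - q) = (z - q) + (1 - m%:~R)%:C%C.
  by rewrite intrB rmorphB /= rmorph_int; ring.
move: hq m1 m2; rewrite /nsq; case: (z - q) => x y /= hq m1 m2.
set t := x + (1 - m%:~R).
have t2 : t < 2 by rewrite /t; lra.
have t1 : 1 <= t by rewrite /t; lra.
rewrite t1 t2 addr0 /=.
have : 0 <= (2 - t) * (2 + t) by rewrite mulr_ge0; lra.
by have := sqr_ge0 x; lra.
Qed.

End Eisenstein.

(** * A congruence subgroup generated by elementary matrices *)

Section CongruenceSubgroup.
Variables (R : realType) (omega : R[i]).
Hypothesis homega : 3.-primitive_root omega.
Local Notation C := (R[i]).
Local Notation O := (Zadjoin omega).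
Local Notation lam := (lam omega).

Definition elmx (i j : 'I_3) (x : C) : 'M[C]_3 := 1%:M + x *: delta_mx i j.

Lemma mul_elmx (M : 'M[C]_3) i j x k l :
  (M *m elmx i j x) k l = M k l + (M k i * x) *+ (l == j).
Proof.
rewrite mulmxDr mulmx1 -scalemxAr !mxE; congr (_ + _).
rewrite (bigD1 i) //= big1 => [|m mi]; last by rewrite mxE (negPf mi) mulr0.
by rewrite mxE eqxx /= addr0 eq_sym; case: eqP => _; rewrite ?mulr1 ?mulr0 ?mulr1n // mulrC.
Qed.

Lemma mul_elmxN (M : 'M[C]_3) i j x : i != j -> M *m elmx i j x *m elmx i j (- x) = M.
Proof.
move=> ij; apply/matrixP => k l; rewrite !mul_elmx (negPf ij) mulr0n addr0.
by rewrite mulrN mulNrn addrK.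
Qed.

Lemma det_elmx i j x : i != j -> \det (elmx i j x) = 1.
Proof.
move=> ij; rewrite det3E !mxE.
by move: ij; move: i j; do 2 apply: forall3; move=> // _; rewrite /=; ring.
Qed.

(** Exponents of lambda. By [expo_trans] the matrices that are the identity
    modulo these powers are stable under the elementary column operations
    with coefficients in the same powers. Opposite exponents add up to 2,
    which is what makes the descent in [pair_step] terminate. *)
Definition expo (i j : 'I_3) : nat :=
  nth 0%N (nth [::] [:: [:: 0; 1; 0]; [:: 1; 2; 1]; [:: 2; 1; 2]]%N i) j.

Lemma expo_trans i j k : i != j -> (expo k j <= expo k i + expo i j)%N.
Proof. by move: i j k; do 3 apply: forall3. Qed.

Lemma expo_sym i j : i != j -> (expo i j + expo j i = 2)%N.
Proof. by move: i j; do 2 apply: forall3. Qed.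

Definition in_order (M : 'M[C]_3) : Prop :=
  forall i j, exists2 w, O w & M i j = (i == j)%:R + lam ^+ expo i j * w.

Lemma in_order_O M i j : in_order M -> O (M i j).
Proof.
move=> oM; have [w Ow ->] := oM i j; apply: O_add; first exact: O_nat.
by apply: O_mul => //; exact: (O_exp homega _ (O_lam homega)).
Qed.

Lemma in_order_mul M i j c : i != j -> O c -> in_order M ->
  in_order (M *m elmx i j (lam ^+ expo i j * c)).
Proof.
move=> ij Oc HM k l; rewrite mul_elmx; have [lj|] := eqVneq l j; last first.
  by move=> _; rewrite mulr0n addr0; exact: HM.
rewrite lj mulr1n; have [w Ow ->] := HM k j; have [v Ov ->] := HM k i.
have Ol n : O (lam ^+ n) by exact: (O_exp homega _ (O_lam homega)).
have [ki|ki] := eqVneq k i.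
  exists (w + c + lam ^+ expo i i * v * c).
    by do !(apply: O_add || apply: O_mul) => //.
  by rewrite ki /= mulr1n; move: (lam ^+ _) (lam ^+ _) => a b; ring.
have := expo_trans k ij => /subnK e.
exists (w + lam ^+ (expo k i + expo i j - expo k j) * v * c).
  by do !(apply: O_add || apply: O_mul) => //.
rewrite mulr0n add0r (_ : lam ^+ _ * v * _ = lam ^+ (expo k i + expo i j) * (v * c)).
  by rewrite -{1}e exprD; move: (lam ^+ _) (lam ^+ _) => a b; ring.
by rewrite exprD; move: (lam ^+ _) (lam ^+ _) => a b; ring.
Qed.

Lemma reduce_mod (a b : C) : b != 0 -> exists2 c, O c & nsq (a + b * c) <= nsq b / 3.
Proof.
move=> b0; have [q Oq hq] := O_round homega (a / b).
exists (- q); first exact: O_opp.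
rewrite (_ : a + b * - q = b * (a / b - q)); last by field.
by rewrite nsqM; have := nsq_ge0 b; nra.
Qed.

Variable H : 'M[C]_3 -> Prop.
Hypothesis HM : forall A B, H A -> H B -> H (A *m B).
Hypothesis Hel : forall i j c, i != j -> O c -> H (elmx i j (lam ^+ expo i j * c)).

(** Column operations with indices in J, recorded through the properties that
    the descent uses: H goes back from M' to M, and rows that vanish on J
    stay as they are. *)
Definition reduces (J : pred 'I_3) (M M' : 'M[C]_3) : Prop :=
  [/\ H M' -> H M, in_order M', \det M' = \det M,
      forall r, (forall i, J i -> M r i = 0) -> row r M' = row r M &
      forall l, ~~ J l -> col l M' = col l M].

Lemma reduces_trans J M1 M2 M3 : reduces J M1 M2 -> reduces J M2 M3 -> reduces J M1 M3.
Proof.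
move=> [h1 _ d1 r1 c1] [h2 o2 d2 r2 c2]; split=> //.
- by move=> h; exact/h1/h2.
- by rewrite d2.
- move=> r Mr; rewrite r2 ?r1 // => i Ji.
  by have /rowP/(_ i) := r1 r Mr; rewrite !mxE => ->; exact: Mr.
- by move=> l Jl; rewrite c2 ?c1.
Qed.

Lemma reduces_el (J : pred 'I_3) M i j c : i != j -> J i -> J j -> O c -> in_order M ->
  reduces J M (M *m elmx i j (lam ^+ expo i j * c)).
Proof.
move=> ij Ji Jj Oc oM; split.
- move=> h; rewrite -[M](mul_elmxN _ (lam ^+ expo i j * c) ij) -mulrN.
  by apply: HM => //; apply: Hel => //; exact: O_opp.
- exact: in_order_mul.
- by rewrite det_mulmx det_elmx // mulr1.
- move=> r Mr; apply/rowP => k; rewrite [LHS]mxE [RHS]mxE mul_elmx.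
  by rewrite (Mr i Ji) mul0r mul0rn addr0.
- move=> l Jl; apply/colP => k; rewrite [LHS]mxE [RHS]mxE mul_elmx.
  by have [lj|_] := eqVneq l j; [rewrite lj Jj in Jl|rewrite mulr0n addr0].
Qed.

(** Either of the two entries can be reduced modulo a multiple of the other,
    with a remainder of squared modulus at most a third of that of the
    multiple. As the two exponents add up to 2, one of the two reductions
    makes its entry smaller unless there is a tie, and [nsq_unit_mod]
    excludes ties. *)
Lemma pair_step (J : pred 'I_3) M k i : i != k -> k != 0 -> J i -> J k ->
  in_order M -> M k i != 0 ->
  exists M', [/\ reduces J M M', forall j, j != i -> j != k -> M' k j = M k j &
    nsq (M' k i) + nsq (M' k k) < nsq (M k i) + nsq (M k k)].
Proof.
move=> ik k0 Ji Jk oM nz.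
have [w Ow yE] := oM k i; have [v Ov zE] := oM k k.
have ki : k != i by rewrite eq_sym.
have ekk : expo k k = 2%N by move: (k) k0; apply: forall3.
rewrite (negPf ki) add0r in yE; rewrite eqxx /= mulr1n ekk in zE.
have esum := expo_sym ik.
have lam_n0 n : lam ^+ n != 0 by rewrite expf_neq0 // lam_neq0.
have nlam n : nsq (lam ^+ n) = 3 ^+ n by rewrite nsq_exp nsq_lam.
have p3 n : 0 < 3 ^+ n :> R by rewrite exprn_gt0.
have zw : nsq (M k k) != 3 * nsq w by rewrite zE; exact: nsq_unit_mod.
have z0 : M k k != 0.
  have := nsq_unit_mod homega Ov (O_0 homega); rewrite -zE -nsq_eq0.
  by rewrite (_ : nsq 0 = 0) ?mulr0 //; apply/eqP; rewrite nsq_eq0.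
have ny : nsq (M k i) * 3 ^+ expo i k = 9 * nsq w.
  by rewrite yE nsqM nlam mulrAC -exprD addnC esum; ring.
have [lt|] := ltP (9 * nsq w) (3 * nsq (M k k)).
  have [c Oc hc] := reduce_mod (M k k) (mulf_neq0 (lam_n0 (expo i k)) nz).
  exists (M *m elmx i k (lam ^+ expo i k * c)); split.
  - exact: reduces_el.
  - by move=> j ji jk; rewrite mul_elmx (negPf jk) mulr0n addr0.
  rewrite !mul_elmx (negPf ik) eqxx mulr0n mulr1n addr0 ltrD2l.
  rewrite mulrA [M k i * _]mulrC; apply: le_lt_trans hc _.
  by rewrite nsqM nlam [3 ^+ _ * _]mulrC ny; lra.
rewrite le_eqVlt => /orP[/eqP e|lt].
  by case/eqP: zw; lra.
have [c Oc hc] := reduce_mod (M k i) (mulf_neq0 (lam_n0 (expo k i)) z0).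
exists (M *m elmx k i (lam ^+ expo k i * c)); split.
- exact: reduces_el.
- by move=> j ji jk; rewrite mul_elmx (negPf ji) mulr0n addr0.
rewrite !mul_elmx (negPf ki) eqxx mulr0n mulr1n addr0 ltrD2r.
rewrite mulrA [M k k * _]mulrC; apply: le_lt_trans hc _.
rewrite nsqM nlam -(ltr_pM2r (p3 (expo i k))) ny.
rewrite (_ : _ * _ * 3 ^+ _ = 3 ^+ (expo i k + expo k i) * nsq (M k k) / 3); last first.
  rewrite exprD; move: (3 ^+ _ : R) (3 ^+ _ : R) => A B; ring.
by rewrite esum; lra.
Qed.

(** Descent on the sum of the squared moduli in row k, which is a natural
    number. *)
Lemma clear_row (J I : pred 'I_3) k : k != 0 -> J k ->
  (forall i, I i -> J i && (i != k)) ->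
  forall M, in_order M -> exists2 M', reduces J M M' & forall i, I i -> M' k i = 0.
Proof.
move=> k0 Jk IJ M oM.
have [n] : exists n : nat, \sum_i nsq (M k i) < n%:R.
  exists (Num.bound (\sum_i nsq (M k i))); apply: le_lt_trans (archi_boundP _).
    exact: lexx.
  by apply: sumr_ge0 => i _; exact: nsq_ge0.
elim: n M oM => [|n IH] M oM hn.
  move: hn; rewrite ltNge; case/negP; apply: sumr_ge0 => i _; exact: nsq_ge0.
have [[i [Ii nz]]|none] := pselect (exists i, I i /\ M k i != 0); last first.
  exists M; first by split.
  by move=> i Ii; apply/eqP/negP => /negP nz; apply: none; exists i.
have /andP[Ji ik] := IJ i Ii.
have [M1 [red1 same lt]] := pair_step ik k0 Ji Jk oM nz.
have O1 : in_order M1 by case: red1.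
case: (IH M1 O1) => [|M2 red2 z2]; last by exists M2 => //; exact: reduces_trans red1 red2.
have nat_row N : in_order N -> exists m : nat, \sum_i nsq (N k i) = m%:R.
  move=> oN; have ex i' : exists m : nat, nsq (N k i') = m%:R.
    by apply: (O_nsq homega); exact: in_order_O.
  have [f fE] := choice ex; exists (\sum_i' f i')%N.
  by rewrite natr_sum; apply: eq_bigr.
have lt1 : \sum_i' nsq (M1 k i') < \sum_i' nsq (M k i').
  rewrite (bigD1 i) //= (bigD1 k) /=; last by rewrite eq_sym.
  rewrite [X in _ < X](bigD1 i) //= [X in _ < _ + X](bigD1 k) /=; last by rewrite eq_sym.
  rewrite (eq_bigr (fun i' => nsq (M k i'))); first by lra.
  by move=> i' /andP[ii' ki']; rewrite same.
have [m1 e1] := nat_row _ O1; have [m2 e2] := nat_row _ oM.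
move: lt1 hn; rewrite e1 e2 !ltr_nat ltnS => l1 l2; exact: leq_trans l1 l2.
Qed.

(** Once the last row and then the middle row are cleared, their diagonal
    entries are units that are 1 modulo lambda^2, hence equal to 1; a product
    of three elementary matrices remains. *)
Theorem congruence_generated M : in_order M -> \det M = 1 -> H M.
Proof.
move=> oM dM.
have [M1 [h1 o1 d1 _ _] z1] :=
  @clear_row predT [pred i | i != 2] 2 isT isT (fun i h => h) M oM.
have sub i : pred1 0 i -> [pred i : 'I_3 | i != 2] i && (i != 1) by move=> /eqP ->.
have [M2 [h2 o2 d2 r2 c2] z2] :=
  @clear_row [pred i | i != 2] (pred1 0) 1 isT isT sub M1 o1.
apply/h1/h2.
have row2 j : M2 2 j = M1 2 j by have /rowP/(_ j) := r2 2 z1; rewrite !mxE.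
have e20 : M2 2 0 = 0 by rewrite row2 z1.
have e21 : M2 2 1 = 0 by rewrite row2 z1.
have e10 : M2 1 0 = 0 by rewrite z2.
have dE : M2 0 0 * (M2 1 1 * M2 2 2) = 1.
  by rewrite -dM -d1 -d2 det3E e20 e21 e10; ring.
have O2 i j := in_order_O i j o2.
have unit1 k w : k != 0 -> O w -> M2 k k * w = 1 -> M2 k k = 1.
  move=> k0 Ow e; have ekk : expo k k = 2%N by move: (k) k0; apply: forall3.
  have w0 : w != 0 by apply/eqP => w0; move: e; rewrite w0 mulr0 => /eqP; rewrite eq_sym oner_eq0.
  have n1 : nsq (M2 k k) <= 1.
    have : nsq (M2 k k) * nsq w = 1 by rewrite -nsqM e /nsq /= expr0n addr0 expr1n.
    have := O_nsq_ge1 homega Ow w0; have := nsq_ge0 (M2 k k); nra.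
  have [v Ov E] := o2 k k; rewrite eqxx /= mulr1n ekk in E.
  suff v0 : v = 0 by rewrite E v0 mulr0 addr0.
  apply/eqP; rewrite -nsq_eq0; apply/eqP.
  have [n nE] := O_nsq homega Ov.
  have : 9 * nsq v <= 4.
    rewrite (_ : 9 * nsq v = nsq (M2 k k - 1)); last first.
      by rewrite E addrC addKr nsqM nsq_exp (nsq_lam homega); ring.
    move: n1; rewrite /nsq; case: (M2 k k) => a b /=; rewrite subr0.
    by have := sqr_ge0 (a + 1); have := sqr_ge0 b; nra.
  rewrite nE; case: (n) => // m; have := ler0n R m; rewrite -natr1; lra.
have e22 : M2 2 2 = 1.
  by apply: (unit1 2 _ isT (O_mul (O2 0 0) (O2 1 1))); rewrite -dE; ring.
have e11 : M2 1 1 = 1.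
  by apply: (unit1 1 _ isT (O_mul (O2 0 0) (O2 2 2))); rewrite -dE; ring.
have e00 : M2 0 0 = 1 by move: dE; rewrite e11 e22 !mulr1.
have [s Os sE] := o2 1 2; have [b Ob bE] := o2 0 1; have [v Ov vE] := o2 0 2.
rewrite add0r in sE bE vE.
have -> : M2 = elmx 1 2 (lam ^+ expo 1 2 * s) *m elmx 0 1 (lam ^+ expo 0 1 * b)
               *m elmx 0 2 (lam ^+ expo 0 2 * v).
  apply/matrixP => i j; rewrite !mul_elmx !mxE.
  by move: i j; do 2 apply: forall3; rewrite ?e00 ?e11 ?e22 ?e10 ?e20 ?e21 ?sE ?bE ?vE /=;
    rewrite ?mulr0n ?mulr1n; ring.
by do !apply: HM => //; exact: Hel.
Qed.
End CongruenceSubgroup.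

(** * Computation with words in two integral matrices *)

Local Notation Z := BinNums.Z.

Section AlternatingProducts.
Variables (T : Type) (mul : T -> T -> T) (one : T).

Definition zpow (x xi : T) (n : int) : T :=
  match n with
  | Posz k => iter k (mul x) one
  | Negz k => iter k.+1 (mul xi) one
  end.

(** x^n0 y^n1 x^n2 and so on, for s = [:: n0; n1; n2; ...]. The group law is
    a parameter since the same word is evaluated in PSL_3(C) and on integral
    matrices. *)
Fixpoint altprod (x xi y yi : T) (s : seq int) : T :=
  if s is n :: s' then mul (zpow x xi n) (altprod y yi x xi s') else one.
End AlternatingProducts.

Definition eis_add (x y : Z * Z) : Z * Z := (x.1 + y.1, x.2 + y.2).
Definition eis_mul (x y : Z * Z) : Z * Z :=
  (x.1 * y.1 - x.2 * y.2, x.1 * y.2 + x.2 * y.1 - x.2 * y.2).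

(** Matrices over Z[omega] in the basis 1, omega, with binary integers: words
    are multiplied out by computation. *)
Definition emx := seq (seq (Z * Z)).
Definition ent (m : emx) (i j : nat) : Z * Z := nth (0, 0) (nth [::] m i) j.
Definition emx_tab (f : nat -> nat -> Z * Z) : emx :=
  [seq [seq f i j | j <- [:: 0; 1; 2]%N] | i <- [:: 0; 1; 2]%N].
Definition emx_mul (m n : emx) : emx := emx_tab (fun i j =>
  eis_add (eis_add (eis_mul (ent m i 0) (ent n 0 j)) (eis_mul (ent m i 1) (ent n 1 j)))
          (eis_mul (ent m i 2) (ent n 2 j))).
Definition emx_scal (s : Z * Z) (m : emx) : emx :=
  emx_tab (fun i j => eis_mul s (ent m i j)).
Definition emx1 : emx :=
  emx_tab (fun i j => if i == j then (1, 0) else (0, 0)).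
Definition emx_el (i j : nat) (x : Z * Z) : emx :=
  emx_tab (fun k l => if (k == i) && (l == j) then x else
                      if k == l then (1, 0) else (0, 0)).

Section Evaluation.
Variables (R : realType) (omega : R[i]).
Hypothesis homega : 3.-primitive_root omega.
Local Notation C := (R[i]).
Local Notation O := (Zadjoin omega).

Definition zC (x : Z) : C := (int_of_Z x)%:~R.
Definition eC (x : Z * Z) : C := zC x.1 + zC x.2 * omega.

Lemma zCD x y : zC (x + y) = zC x + zC y.
Proof. by rewrite /zC rmorphD intrD. Qed.
Lemma zCB x y : zC (x - y) = zC x - zC y.
Proof. by rewrite /zC rmorphB intrB. Qed.
Lemma zCM x y : zC (x * y) = zC x * zC y.
Proof. by rewrite /zC rmorphM intrM. Qed.

Lemma zCN x : zC (- x) = - zC x.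
Proof. by rewrite /zC rmorphN mulrNz. Qed.
Lemma zC_nat n : zC n%:R = n%:R.
Proof. by rewrite /zC rmorph_nat mulrz_nat. Qed.
Definition zCE := (zCN, zC_nat 0, zC_nat 1, zC_nat).

Lemma eCD x y : eC (eis_add x y) = eC x + eC y.
Proof. by rewrite /eC /= !zCD; ring. Qed.
Lemma eCM x y : eC (eis_mul x y) = eC x * eC y.
Proof.
rewrite /eC /= !zCB zCD !zCM; have := omega_sq homega.
by move: (zC x.1) (zC x.2) (zC y.1) (zC y.2) => a b c d e; ring: e.
Qed.
Lemma eC0 : eC (0, 0) = 0. Proof. by rewrite /eC /zC /= mul0r addr0. Qed.
Lemma eC1 : eC (1, 0) = 1. Proof. by rewrite /eC /zC /= mul0r addr0. Qed.

Lemma eC_O x : O (eC x).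
Proof. by apply/(O_basisP homega); exists (int_of_Z x.1), (int_of_Z x.2). Qed.

Lemma eC_eq0 x : eC x = 0 -> x = (0, 0).
Proof.
move=> e0; have := nsq_O homega (int_of_Z x.1) (int_of_Z x.2).
rewrite -/(zC _) -/(zC _) -/(eC x) e0 (_ : nsq 0 = 0); last by apply/eqP; rewrite nsq_eq0.
case: x {e0} => a b /= /esym/eqP; rewrite intr_eq0 => /eqP e.
have [ea eb] : int_of_Z a = 0 /\ int_of_Z b = 0.
  have h : (2 * int_of_Z a - int_of_Z b) ^+ 2 + 3 * int_of_Z b ^+ 2 = 0.
    by rewrite (_ : _ + _ = 4 * (int_of_Z a ^+ 2 - int_of_Z a * int_of_Z b + int_of_Z b ^+ 2));
      [rewrite e|ring].
  by split; nia.
by rewrite -(int_of_ZK a) -(int_of_ZK b) ea eb.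
Qed.

Definition toM (m : emx) : 'M[C]_3 := \matrix_(i, j) eC (ent m i j).

Lemma ent_tab f (i j : 'I_3) : ent (emx_tab f) i j = f i j.
Proof. by move: i j; do 2 apply: forall3. Qed.

Lemma toM_mul m n : toM (emx_mul m n) = toM m *m toM n.
Proof.
apply/matrixP => i j; rewrite !mxE ent_tab !eCD !eCM sum3E.
by rewrite ![toM _ _ _]mxE.
Qed.

Lemma toM_scal s m : toM (emx_scal s m) = eC s *: toM m.
Proof. by apply/matrixP => i j; rewrite !mxE ent_tab eCM. Qed.

Lemma toM1 : toM emx1 = 1%:M.
Proof.
apply/matrixP => i j; rewrite !mxE ent_tab.
by rewrite -val_eqE; case: eqP => _; rewrite ?eC1 ?eC0.
Qed.

Lemma toM_el (i j : 'I_3) x : i != j -> toM (emx_el i j x) = elmx i j (eC x).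
Proof.
move=> ij; apply/matrixP => k l; rewrite !mxE ent_tab !val_eqE.
have [ki|ki] := eqVneq k i; have [lj|lj] := eqVneq l j; rewrite /= ?mulr0 ?addr0 ?mulr1.
- by rewrite ki lj (negPf ij) add0r.
- by case: eqP => _; rewrite ?eC0 ?eC1.
- by case: eqP => _; rewrite ?eC0 ?eC1.
- by case: eqP => _; rewrite ?eC0 ?eC1.
Qed.

(** Up to scalars: the denominators and the powers of r in the generators
    disappear. *)
Definition represents (m : emx) (x : PSL R 3) : Prop :=
  exists2 N : SL R 3, x = PSL_class N & exists2 c, c != 0 & SLval N = c *: toM m.

Lemma represents1 : represents emx1 1%g.
Proof. by exists (SL_one R 3) => //; exists 1; rewrite ?oner_neq0 // toM1 scale1r. Qed.

Lemma representsM m n x y : represents m x -> represents n y -> represents (emx_mul m n) (x * y)%g.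
Proof.
move=> [M -> [c c0 ME]] [N -> [d d0 NE]]; exists (SL_mul M N).
  by rewrite [LHS]PSL_mulE.
exists (c * d); first by rewrite mulf_neq0.
by rewrite /= ME NE toM_mul -scalemxAl -scalemxAr scalerA.
Qed.

Lemma represents_eq m n s t x y : represents m x -> represents n y -> s != (0, 0) -> t != (0, 0) ->
  emx_scal t m = emx_scal s n -> x = y.
Proof.
move=> [M -> [c c0 ME]] [N -> [d d0 NE]] s0 t0 mE; apply/PSL_classP.
have et0 : eC t != 0 by apply/eqP => /eC_eq0 e0; rewrite e0 eqxx in t0.
exists (c * eC s / (d * eC t)).
have -> : SLval M = (c / eC t) *: toM (emx_scal t m).
  by rewrite toM_scal scalerA divfK.
rewrite mE NE toM_scal !scalerA; congr (_ *: _).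
by field; rewrite d0 et0.
Qed.

Lemma representsV m m' s x : represents m x -> s != (0, 0) ->
  emx_mul m m' = emx_scal s emx1 -> represents m' x^-1%g.
Proof.
move=> [M -> [c c0 ME]] s0 e.
have es0 : eC s != 0 by apply/eqP => /eC_eq0 e0; rewrite e0 eqxx in s0.
exists (SL_inv M); first by apply/(@mulg1_eq (PSL R 3)); rewrite [LHS]PSL_mulE SL_mulxV.
exists (c * eC s)^-1; first by rewrite invr_eq0 mulf_neq0.
have MU := SL_unit M.
apply: (can_inj (mulKmx MU)); rewrite /= mulmxV // ME.
rewrite -scalemxAl -scalemxAr scalerA -toM_mul e toM_scal toM1 scalerA.
by rewrite -[c / _ * _]mulrAC divff ?scale1r // mulf_neq0.
Qed.

Lemma represents_zpow m m' x n : represents m x -> represents m' x^-1%g ->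
  represents (zpow emx_mul emx1 m m' n) (zpow (fun x y : PSL R 3 => (x * y)%g) 1%g x x^-1%g n).
Proof.
move=> rm rm'; case: n => n /=.
  by elim: n => [|n IH]; [exact: represents1|exact: representsM].
by apply: representsM => //; elim: n => [|n IH]; [exact: represents1|exact: representsM].
Qed.

Lemma represents_altprod m m' n n' x y s :
  represents m x -> represents m' x^-1%g -> represents n y -> represents n' y^-1%g ->
  represents (altprod emx_mul emx1 m m' n n' s)
      (altprod (fun x y : PSL R 3 => (x * y)%g) 1%g x x^-1%g y y^-1%g s).
Proof.
elim: s m m' n n' x y => [|k s IH] m m' n n' x y rm rm' rn rn' /=; first exact: represents1.
by apply: representsM; [exact: represents_zpow|exact: IH].
Qed.

End Evaluation.

(** * The integral group and its residues modulo 3 *)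

Section IntegralGroup.
Variables (R : realType) (omega : R[i]).
Hypothesis homega : 3.-primitive_root omega.
Local Notation C := (R[i]).
Local Notation O := (Zadjoin omega).
Local Notation P := (PSL_over (n := 3) O).

Lemma O_prod n (F : 'I_n -> C) : (forall i, O (F i)) -> O (\prod_i F i).
Proof.
by move=> OF; elim/big_ind: _ => [|x y|i _]; [exact: O_1|exact: O_mul|exact: OF].
Qed.

Lemma O_det n (M : 'M[C]_n) : (forall i j, O (M i j)) -> O (\det M).
Proof.
move=> OM'; rewrite /determinant; elim/big_ind: _ => [|x y|s _].
- exact: O_0.
- exact: O_add.
- apply: O_mul; last exact: O_prod.
  by apply: O_exp => //; apply: O_opp; exact: O_1.
Qed.

Lemma O_inv n (M : SL R n) :
  (forall i j, O (SLval M i j)) -> forall i j, O (invmx (SLval M) i j).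
Proof.
move=> OM' i j; rewrite /invmx SL_unit (eqP (SL_det M)) invr1 scale1r mxE /cofactor.
apply: O_mul; first by apply: O_exp => //; apply: O_opp; exact: O_1.
by apply: O_det => k l; rewrite !mxE.
Qed.

Lemma O_mulmx n (M N : 'M[C]_n) : (forall i j, O (M i j)) -> (forall i j, O (N i j)) ->
  forall i j, O ((M *m N) i j).
Proof. by move=> hM hN i j; rewrite mxE; apply: O_sum => // k; exact: O_mul. Qed.

Lemma PSL_classM (M N : SL R 3) :
  (PSL_class M * PSL_class N)%g = PSL_class (M * N)%g.
Proof. exact: PSL_mulE. Qed.

Lemma PSL_classV (M : SL R 3) : (PSL_class M)^-1%g = PSL_class (M^-1)%g.
Proof.
by apply: (@mulg1_eq (PSL R 3)); rewrite PSL_classM mulgV.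
Qed.

Lemma PSL_over_subgroup : is_subgroup P.
Proof.
split.
- exists (SL_one R 3) => // i j; rewrite /= mxE; exact: O_nat.
- move=> _ _ [M OM' <-] [N ON' <-]; exists (M * N)%g; last by rewrite PSL_classM.
  exact: O_mulmx.
- move=> _ [M OM' <-]; exists (M^-1)%g; last by rewrite PSL_classV.
  exact: O_inv.
Qed.

(** A relation and not a function, because it depends on the choice of a
    representative. *)
Definition residues (x : PSL R 3) (f : {ffun 'I_3 * 'I_3 -> 'I_3 * 'I_3}) : Prop :=
  exists2 M : SL R 3, PSL_class M = x & forall i j, exists2 w, O w &
    SLval M i j = ((f (i, j)).1)%:R + ((f (i, j)).2)%:R * omega + 3 * w.

Lemma residues_ex x : P x -> exists f, residues x f.
Proof.
move=> [M /= hM <-].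
have H (ij : 'I_3 * 'I_3) : exists f : 'I_3 * 'I_3, exists2 w, O w &
    SLval M ij.1 ij.2 = (f.1)%:R + (f.2)%:R * omega + 3 * w.
  have /(O_basisP homega) [a [b ->]] := hM ij.1 ij.2.
  have m3 (c : int) : exists k : 'I_3, exists d : int, c = Posz k + 3 * d.
    have lt : ssrnat.leq (absz (modz c 3)).+1 3.
      by rewrite -ltz_nat gez0_abs ?modz_ge0 // ltz_pmod.
    exists (Ordinal lt), (divz c 3); rewrite /= gez0_abs ?modz_ge0 //.
    by rewrite addrC mulrC -divz_eq.
  have [k [d ->]] := m3 a; have [l [e ->]] := m3 b.
  exists (k, l), (d%:~R + e%:~R * omega); first by apply/(O_basisP homega); exists d, e.
  by rewrite /= !intrD !intrM -!pmulrn; ring.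
have [f fE] := choice H; exists (finfun f), M => // i j.
by rewrite !ffunE; exact: (fE (i, j)).
Qed.

(** M^-1 N = 1 + M^-1 (N - M), where M^-1 is integral. *)
Lemma residues_eq x y f : residues x f -> residues y f ->
  exists2 M : SL R 3, PSL_class M = (x^-1 * y)%g &
    forall i j, exists2 w, O w & SLval M i j = (i == j)%:R + 3 * w.
Proof.
move=> [M <- hM] [N <- hN].
have Off i j : O (((f (i, j)).1)%:R + ((f (i, j)).2)%:R * omega).
  apply: O_add; first exact: O_nat.
  by apply: O_mul; [exact: O_nat|exact: O_omega].
exists (M^-1 * N)%g; first by rewrite -PSL_classM -PSL_classV.
have OM' i j : O (SLval M i j).
  have [w Ow ->] := hM i j; apply: O_add => //; apply: O_mul => //; exact: O_nat.
have OI := O_inv OM'.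
have diff i j : exists w, O w /\ SLval N i j = SLval M i j + 3 * w.
  have [w Ow ->] := hM i j; have [v Ov ->] := hN i j.
  by exists (v - w); split; [exact: O_sub|ring].
have diff' (ij : 'I_3 * 'I_3) := diff ij.1 ij.2.
have [g gE] := choice diff'.
pose D : 'M[C]_3 := \matrix_(i, j) g (i, j).
have NE : SLval N = SLval M + 3 *: D.
  by apply/matrixP => i j; rewrite !mxE; exact: (gE (i, j)).2.
move=> i j; exists ((invmx (SLval M) *m D) i j).
  by apply: O_mulmx => // k l; rewrite mxE; exact: (gE (k, l)).1.
rewrite /= -/(SLval N) NE mulmxDr mulVmx ?SL_unit // -scalemxAr.
by rewrite !mxE.
Qed.

End IntegralGroup.

(** * Commensurability *)

(** 3 r^-2 mxA and 3 r^-1 mxB; the primed matrices are multiples of their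
    inverses. *)
Definition exA : emx :=
  [:: [:: (0, 3); (-1, -2); (-2, -1)]; [:: (-3, 0); (0, -3); (-1, -2)];
      [:: (-3, -3); (3, 0); (3, 0)]].
Definition exA' : emx :=
  [:: [:: (1, -1); (-1, 1); (0, -1)]; [:: (2, 1); (-1, 1); (0, 0)];
      [:: (0, 0); (-1, -2); (2, 1)]].
Definition exB : emx :=
  [:: [:: (0, 0); (0, 0); (2, 1)]; [:: (3, 0); (0, 0); (3, 3)];
      [:: (0, 0); (3, 0); (0, 3)]].
Definition exB' : emx :=
  [:: [:: (-3, -3); (2, 1); (0, 0)]; [:: (0, -3); (0, 0); (2, 1)];
      [:: (3, 0); (0, 0); (0, 0)]].
Definition exword (s : seq int) : emx := altprod emx_mul emx1 exA exA' exB exB' s.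


(** Multiplying crosswise by the corner entries tests proportionality. *)
Definition is_word (s : seq int) (n : emx) : bool :=
  let m := exword s in
  [&& ent m 0 0 != (0, 0), ent n 0 0 != (0, 0) &
      emx_scal (ent n 0 0) m == emx_scal (ent m 0 0) n].

Definition lam_mul (k : nat) (c : Z * Z) : Z * Z := iter k (eis_mul (1, -1)) c.

(** These words come from a breadth-first search in the group generated by
    the two matrices. *)
Definition el_word (c : bool) (i j : nat) : seq int := nth [::] (nth [::] (if c then
  [:: [:: [::]; [:: 0; 3; 3; -3; 6]; [:: 0; 2; 1; 3; 1; 1; -2; -3]];
      [:: [:: 1; 2; 1; -2; -2; 1; 1; 1; -1; 1]; [::];
          [:: -1; 1; 1; -1; 1; -1; -3; -2; -2; -1; 1; 1]];
      [:: [:: 0; 1; -1; 1; 1; -1; 1; -1; -3; -2; -2; -1; 1];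
          [:: 0; 1; -1; 4; 1; -2]; [::]]]
  else
  [:: [:: [::]; [:: -3; -5; 2; -3; 1; -1]; [:: 0; -1; 2; -3; -3; -2; 1]];
      [:: [:: 2; -3; -3; -2; 1; -1]; [::]; [:: 0; 2; 1; -1; 5; 2; 1; 1; -1; 2]];
      [:: [:: 0; 3; 1; -1; 5; 2; 1; 1; -1; 1]; [:: 0; 3; 1; -1; -1; 1]; [::]]]) i) j.

Lemma el_wordP (c : bool) (i j : 'I_3) : i != j ->
  is_word (el_word c i j)
    (emx_el i j (lam_mul (expo i j) (if c then (0, 1) else (1, 0)))).
Proof.
by move: i j; do 2 apply: forall3; move=> //= _; case: c; vm_compute.
Qed.

Section Image.
Variables (R : realType) (omega r : R[i]).
Hypothesis homega : 3.-primitive_root omega.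
Hypothesis hr : r ^+ 3 = 1 - omega.
Local Notation C := (R[i]).
Local Notation O := (Zadjoin omega).
Local Notation P := (PSL_over (n := 3) O).
Local Notation lam := (lam omega).
Variables (a b : PSL R 3).
Hypothesis ha : PSL_class_of (mxA omega r) a.
Hypothesis hb : PSL_class_of (mxB omega r) b.

Lemma r_neq0 : r != 0.
Proof.
apply/eqP => r0; have := lam_neq0 homega; rewrite /lam -hr r0 expr0n eqxx //.
Qed.

Lemma mxA_toM : mxA omega r = (r ^+ 2 / 3) *: toM omega exA.
Proof.
apply/matrixP => i j; rewrite !mxE /ent.
by move: i j; do 2 apply: forall3; rewrite /= /eC /= !zCE; field.
Qed.

Lemma mxB_toM : mxB omega r = (r / 3) *: toM omega exB.
Proof.
apply/matrixP => i j; rewrite !mxE /ent.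
by move: i j; do 2 apply: forall3; rewrite /= /eC /= !zCE; field.
Qed.

Lemma represents_a : represents omega exA a.
Proof.
have [M ME ->] := ha; exists M => //; exists (r ^+ 2 / 3); last by rewrite ME mxA_toM.
by rewrite mulf_neq0 ?expf_neq0 ?r_neq0 // invr_eq0 pnatr_eq0.
Qed.
Lemma represents_b : represents omega exB b.
Proof.
have [M ME ->] := hb; exists M => //; exists (r / 3); last by rewrite ME mxB_toM.
by rewrite mulf_neq0 ?r_neq0 // invr_eq0 pnatr_eq0.
Qed.
Lemma represents_aV : represents omega exA' a^-1%g.
Proof. by apply: (representsV homega represents_a (s := (3, 3))). Qed.
Lemma represents_bV : represents omega exB' b^-1%g.
Proof. by apply: (representsV homega represents_b (s := (6, 3))). Qed.

Definition gword (s : seq int) : PSL R 3 :=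
  altprod (fun x y : PSL R 3 => (x * y)%g) 1%g a a^-1%g b b^-1%g s.

Lemma represents_word s : represents omega (exword s) (gword s).
Proof.
exact: (represents_altprod homega _ represents_a represents_aV represents_b represents_bV).
Qed.

Lemma is_wordP s n (N : SL R 3) : is_word s n -> SLval N = toM omega n ->
  gword s = PSL_class N.
Proof.
move=> /and3P[m0 n0 /eqP e] NE; apply: (represents_eq homega (represents_word s) _ m0 n0 e).
by exists N => //; exists 1; rewrite ?oner_neq0 // scale1r.
Qed.

Variable L : set (PSL R 3).
Hypothesis Lsub : is_subgroup L.
Hypothesis La : L a.
Hypothesis Lb : L b.

Lemma gword_in s : L (gword s).
Proof.
case: Lsub => L1 LM LV; rewrite /gword.
have Lz x n : L x -> L (zpow (fun x y : PSL R 3 => (x * y)%g) 1%g x x^-1%g n).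
  move=> Lx; case: n => n /=; first by elim: n => [|n IH] //=; exact: LM.
  by apply: (LM); [exact: LV|elim: n => [|n IH] //=; apply: (LM) => //; exact: LV].
elim: s (a) (b) La Lb => [|n s IH] x y Lx Ly //=.
by apply: LM; [exact: Lz|exact: IH].
Qed.

Definition Lmx (M : 'M[C]_3) : Prop := exists2 N : SL R 3, SLval N = M & L (PSL_class N).

Lemma LmxM A B : Lmx A -> Lmx B -> Lmx (A *m B).
Proof.
case: Lsub => _ LM _; move=> [M <- LMM] [N <- LN]; exists (M * N)%g => //.
by rewrite -PSL_classM; exact: LM.
Qed.

Lemma elmxD i j (x y : C) : i != j -> elmx i j x *m elmx i j y = elmx i j (x + y).
Proof.
move=> ij; apply/matrixP => k l; rewrite mul_elmx !mxE (negPf ij) andbF.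
have [ki|ki] := eqVneq k i; have [lj|lj] := eqVneq l j;
  by rewrite /= ?eqxx /= ?mulr0 ?mulr0n ?mulr1n ?addr0 ?add0r //; ring.
Qed.

Lemma Lmx_elN i j (x : C) : i != j -> Lmx (elmx i j x) -> Lmx (elmx i j (- x)).
Proof.
case: Lsub => _ _ LV; move=> ij [N NE LN]; exists (N^-1)%g; last first.
  by rewrite -PSL_classV; exact: LV.
apply: (can_inj (mulKmx (SL_unit N))); rewrite /= mulmxV ?SL_unit // NE elmxD // subrr.
by rewrite /elmx scale0r addr0.
Qed.

Lemma eC_lam_mul k c : eC omega (lam_mul k c) = lam ^+ k * eC omega c.
Proof.
elim: k => [|k IH] /=; first by rewrite expr0 mul1r.
rewrite eCM // IH exprS mulrA; congr (_ * _ * _).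
by rewrite /eC /= !zCE /lam; ring.
Qed.

(** The admissible coefficients form an additive group, which contains the
    basis 1, omega of O times the given power of lambda. *)
Lemma Lmx_el i j c : i != j -> O c -> Lmx (elmx i j (lam ^+ expo i j * c)).
Proof.
move=> ij /(O_basisP homega) [p [q ->]]; rewrite mulrDr -elmxD //.
have base (c0 : bool) : Lmx (elmx i j (lam ^+ expo i j * (if c0 then omega else 1))).
  have det1 := det_elmx (lam ^+ expo i j * (if c0 then omega else 1)) ij.
  exists (MkSL (introT eqP det1)) => //.
  rewrite -(is_wordP (el_wordP c0 ij)); first exact: gword_in.
  rewrite toM_el // eC_lam_mul /=; congr (elmx _ _ (_ * _)).
  by clear det1; case: c0; rewrite /eC /= !zCE; ring.
have mult (x : C) (n : int) : Lmx (elmx i j x) -> Lmx (elmx i j (x * n%:~R)).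
  move=> Lx; have nat_mult (m : nat) : Lmx (elmx i j (x * m%:R)).
    elim: m => [|m IH]; last by rewrite -natr1 mulrDr mulr1 -elmxD //; exact: LmxM.
    rewrite mulr0 /elmx scale0r addr0; exists (SL_one R 3) => //.
    by case: Lsub.
  case: n => n; first by rewrite -pmulrn; exact: nat_mult.
  by rewrite NegzE mulrNz -pmulrn mulrN; apply: Lmx_elN.
apply: LmxM; first by have := mult _ p (base false); rewrite mulr1.
by rewrite [q%:~R * _]mulrC mulrA; exact: mult (base true).
Qed.

Lemma three_lam : 3 = lam ^+ 2 * (omega + 1).
Proof. by have e := omega_sq homega; rewrite lam_sq //; ring: e. Qed.

(** 3 is a multiple of lambda^2, and no exponent in [expo] is larger than 2. *)
Lemma congruence3_in (M : SL R 3) :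
  (forall i j, exists2 w, O w & SLval M i j = (i == j)%:R + 3 * w) -> L (PSL_class M).
Proof.
move=> hM; have oM : in_order omega (SLval M).
  move=> i j; have [w Ow ->] := hM i j.
  have e2 : (expo i j <= 2)%N by move: (i) (j); do 2 apply: forall3.
  exists (lam ^+ (2 - expo i j) * (omega + 1) * w); last first.
    rewrite three_lam (_ : lam ^+ 2 = lam ^+ expo i j * lam ^+ (2 - expo i j)).
      by rewrite !mulrA.
    by rewrite -exprD subnKC.
  apply: O_mul => //; apply: O_mul; first exact: (O_exp homega _ (O_lam homega)).
  by apply: O_add; [exact: O_omega|exact: O_1].
have [N NE LN] : Lmx (SLval M).
  apply: (congruence_generated homega _ _ oM); last exact/eqP/SL_det.
    by move=> A B; exact: LmxM.
  by move=> i j c; exact: Lmx_el.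
by rewrite (_ : M = N) //; apply: val_inj.
Qed.

(** By [residues_eq] and [congruence3_in] a coset is determined by the
    residues modulo 3 of a representative of any of its elements. *)
Lemma finite_index_integral : finite_index P (P `&` L).
Proof.
have [P1 PM PV] := PSL_over_subgroup homega; have [L1 LM LV] := Lsub.
set K := P `&` L.
pose coset (h : PSL R 3) := [set (h * k)%g | k in K].
have same x y f : P x -> P y -> residues omega x f -> residues omega y f -> coset x = coset y.
  move=> Px Py xf yf; have [M ME hM] := residues_eq homega xf yf.
  have Kxy : K (x^-1 * y)%g.
    by split; [apply: PM => //; exact: PV|rewrite -ME; exact: congruence3_in].
  have KM u v : K u -> K v -> K (u * v)%g by move=> [? ?] [? ?]; split; [exact: PM|exact: LM].
  have KV u : K u -> K u^-1%g by move=> [? ?]; split; [exact: PV|exact: LV].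
  apply/seteqP; split=> _ [k Kk <-].
    exists ((x^-1 * y)^-1 * k)%g; first by apply: KM => //; exact: KV.
    by rewrite invgM invgK -!mulgA mulVKg.
  exists (x^-1 * y * k)%g; first exact: KM.
  by rewrite -!mulgA mulVKg.
pose g f := coset (xget 1%g [set x | P x /\ residues omega x f]).
apply: (@sub_finite_set _ _ (g @` setT)); last by apply: finite_image; exact: finite_finset.
move=> _ [h Ph <-]; have [f hf] := residues_ex homega Ph; exists f => //.
rewrite /g; case: xgetP => [x _ [Px xf]|none]; first exact: same Px Ph xf hf.
by case: (none h).
Qed.


Definition edet (m : emx) : Z * Z :=
  let sub x y := eis_add x (eis_mul (-1, 0) y) in
  let minor i j := sub (eis_mul (ent m 1 i) (ent m 2 j)) (eis_mul (ent m 1 j) (ent m 2 i)) in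
  eis_add (sub (eis_mul (ent m 0 0) (minor 1 2)%N) (eis_mul (ent m 0 1) (minor 0 2)%N))
          (eis_mul (ent m 0 2) (minor 0 1)%N).

Lemma edetE m : \det (toM omega m) = eC omega (edet m).
Proof.
rewrite det3E !mxE /edet !(eCD, eCM homega).
have -> : eC omega (-1, 0) = -1 by rewrite /eC /= !zCE; ring.
by rewrite !mulN1r.
Qed.

Lemma word_integral s n : is_word s n && (edet n == (1, 0)) -> P (gword s).
Proof.
move=> /andP[sn /eqP dn].
have det1 : \det (toM omega n) = 1 by rewrite edetE dn /eC /= !zCE; ring.
rewrite (is_wordP (N := MkSL (introT eqP det1)) sn) //.
by exists (MkSL (introT eqP det1)) => // i j; rewrite /= mxE; exact: eC_O.
Qed.

(** Three values of k suffice, since b^3 is in P; with all of them,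
    invariance under conjugation by b is immediate. *)
Definition Pcore (y : PSL R 3) : Prop :=
  forall k : nat, P (b ^- k * y * b ^+ k)%g.

Lemma b3_integral : P (b ^+ 3)%g.
Proof.
have -> : (b ^+ 3)%g = gword [:: 0; 3].
  by rewrite /gword /= mul1g !mulg1 !expgS expg0 mulg1.
apply: (@word_integral _ [:: [:: (-1, -1); (1, 0); (0, 0)];
  [:: (-1, -2); (1, 0); (1, 0)]; [:: (1, -1); (0, 0); (1, 0)]]).
by vm_compute.
Qed.

Lemma Pcore3 y : (forall k, (k < 3)%N -> P (b ^- k * y * b ^+ k)%g) -> Pcore y.
Proof.
have [P1 PM PV] := PSL_over_subgroup homega; have b3 := b3_integral.
move=> h k; elim/ltn_ind: k => k IH.
have [k3|k3] := ltnP k 3; first exact: h.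
rewrite -(subnK k3) expgnDr invgM.
rewrite (_ : _ * _ * _ = b ^- 3 * (b ^- (k - 3) * y * b ^+ (k - 3)) * b ^+ 3)%g; last first.
  by rewrite !mulgA.
have k' : (k - 3 < k)%N by rewrite -subn_gt0 subKn.
by apply: (PM) => //; apply: (PM); [exact: PV|exact: IH].
Qed.

Lemma PcoreM x y : Pcore x -> Pcore y -> Pcore (x * y)%g.
Proof.
have [P1 PM PV] := PSL_over_subgroup homega.
move=> hx hy k.
rewrite (_ : _ * _ * _ = (b ^- k * x * b ^+ k) * (b ^- k * y * b ^+ k))%g; first exact: PM.
by rewrite -!mulgA mulVKg.
Qed.

Lemma PcoreJ x k : Pcore x -> Pcore (b ^- k * x * b ^+ k)%g.
Proof.
move=> hx l; have := hx (k + l)%N; congr (P _).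
by rewrite expgnDr invgM -!mulgA.
Qed.

(** As Pcore is normalised by b and contains b^3, these elements form a group
    in which Pcore has index at most 3. *)
Definition near_core (x : PSL R 3) := exists n, Pcore (x * b ^+ n)%g.

Lemma near_coreM x y : near_core x -> near_core y -> near_core (x * y)%g.
Proof.
move=> [n hx] [m hy]; exists (m + n)%N.
have := PcoreM hx (PcoreJ n hy); congr Pcore.
by rewrite expgnDr -!mulgA mulVKg.
Qed.

Lemma Pcore_words y (s0 s1 s2 : seq int) (n0 n1 n2 : emx) :
  [&& is_word s0 n0, is_word s1 n1 & is_word s2 n2] ->
  [&& edet n0 == (1, 0), edet n1 == (1, 0) & edet n2 == (1, 0)] ->
  y = gword s0 -> (b ^- 1 * y * b ^+ 1)%g = gword s1 ->
  (b ^- 2 * y * b ^+ 2)%g = gword s2 -> Pcore y.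
Proof.
move=> /and3P[w0 w1 w2] /and3P[d0 d1 d2] e0 e1 e2.
apply: Pcore3 => -[|[|[|//]]] _.
- by rewrite expg0 invg1 mul1g mulg1 e0; apply: (word_integral (n := n0)); rewrite w0 d0.
- by rewrite e1; apply: (word_integral (n := n1)); rewrite w1 d1.
- by rewrite e2; apply: (word_integral (n := n2)); rewrite w2 d2.
Qed.

Lemma near_core_a : near_core a.
Proof.
exists 1%N.
apply: (@Pcore_words _ [:: 1; 1] [:: 0; -1; 1; 2] [:: 0; -2; 1; 3]
  [:: [:: (-1, -1); (-1, 0); (0, -1)]; [:: (-1, -2); (-1, -1); (1, -1)];
      [:: (1, -1); (1, -1); (2, 2)]]
  [:: [:: (-1, -1); (0, 0); (0, -1)]; [:: (-1, -2); (1, 0); (1, 0)];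
      [:: (2, 1); (-1, 1); (0, 1)]]
  [:: [:: (-1, -1); (1, 0); (0, 0)]; [:: (2, 1); (2, 2); (0, 2)];
      [:: (0, 0); (-1, 1); (-1, -1)]]).
- by vm_compute.
- by vm_compute.
- by rewrite /gword /= !(expgS, expg0, mulg1, mul1g, mulgA, invgM, invg1).
- by rewrite /gword /= !(expgS, expg0, mulg1, mul1g, mulgA, invgM, invg1).
- by rewrite /gword /= !(expgS, expg0, mulg1, mul1g, mulgA, invgM, invg1).
Qed.

Lemma near_core_aV : near_core a^-1%g.
Proof.
exists 2%N.
apply: (@Pcore_words _ [:: -1; 2] [:: 0; -1; -1; 3] [:: 0; -2; -1; 4]
  [:: [:: (-1, -1); (0, 0); (0, 0)]; [:: (0, 0); (0, 1); (-1, 0)];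
      [:: (1, -1); (0, 0); (1, 0)]]
  [:: [:: (-1, -1); (0, -1); (0, -1)]; [:: (0, 0); (0, 1); (-1, -1)];
      [:: (0, 0); (0, 0); (1, 0)]]
  [:: [:: (3, 1); (2, 2); (1, 3)]; [:: (1, 2); (0, 1); (-1, 1)];
      [:: (-1, 1); (-1, 1); (-3, -2)]]).
- by vm_compute.
- by vm_compute.
- by rewrite /gword /= !(expgS, expg0, mulg1, mul1g, mulgA, invgM, invg1).
- by rewrite /gword /= !(expgS, expg0, mulg1, mul1g, mulgA, invgM, invg1).
- by rewrite /gword /= !(expgS, expg0, mulg1, mul1g, mulgA, invgM, invg1).
Qed.

Lemma Pcore_b3 : Pcore (b ^+ 3)%g.
Proof.
move=> k; have -> : (b ^- k * b ^+ 3 * b ^+ k)%g = (b ^+ 3)%g; last exact: b3_integral.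
by rewrite -mulgA -expgnDr addnC expgnDr mulKg.
Qed.

Lemma Pcore1 : Pcore 1%g.
Proof.
have [P1 _ _] := PSL_over_subgroup homega.
by move=> k; rewrite mulg1 mulVg.
Qed.

Lemma near_core_b : near_core b.
Proof. by exists 2%N; have := Pcore_b3; rewrite expgS. Qed.

Lemma near_core_bV : near_core b^-1%g.
Proof. by exists 1%N; rewrite expg1 mulVg; exact: Pcore1. Qed.

Lemma near_core_lt3 x : near_core x -> exists2 n, (n < 3)%N & P (x * b ^+ n)%g.
Proof.
have [P1 PM PV] := PSL_over_subgroup homega.
move=> [n]; elim/ltn_ind: n => n IH hx.
have [n3|n3] := ltnP n 3.
  by exists n => //; have := hx 0%N; rewrite expg0 invg1 mul1g mulg1.
apply: (IH (n - 3)%N); first by rewrite -subn_gt0 subKn.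
move=> k; have := PM _ _ (hx k) (PV _ b3_integral); congr (P _).
rewrite -{1}(subnK n3) expgnDr -!mulgA; congr (_ * (_ * (_ * _)))%g.
rewrite (_ : _ * _ = b ^+ (3 + k) / b ^+ 3)%g; first by rewrite addnC expgnDr mulgK.
by rewrite -[(3 + k)%N]/(k.+3) !expgS -!mulgA.
Qed.

(** Each coset contains one of 1, b and b^2. *)
Lemma near_core_in : L `<=` near_core -> finite_index L (P `&` L).
Proof.
have [P1 PM PV] := PSL_over_subgroup homega; have [L1 LM LV] := Lsub.
move=> LC; set K := P `&` L.
pose coset (h : PSL R 3) := [set (h * k)%g | k in K].
apply: (@sub_finite_set _ _ ((fun n => coset (b ^+ n)%g) @` `I_3)); last first.
  by apply: finite_image; exact: finite_II.
move=> _ [h Lh <-].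
have [n n3 hn] := near_core_lt3 (LC _ (LV _ Lh)).
have Lbn m : L (b ^+ m)%g.
  by elim: m => [|m IH]; [rewrite expg0|rewrite expgS; exact: LM].
have Kn : K (h^-1 * b ^+ n)%g by split=> //; apply: LM => //; exact: LV.
exists n => //.
have KM u v : K u -> K v -> K (u * v)%g by move=> [? ?] [? ?]; split; [exact: PM|exact: LM].
have KV u : K u -> K u^-1%g by move=> [? ?]; split; [exact: PV|exact: LV].
apply/seteqP; split=> _ [k Kk <-].
  exists (h^-1 * b ^+ n * k)%g; first exact: KM.
  by rewrite -!mulgA mulVKg.
exists ((h^-1 * b ^+ n)^-1 * k)%g; first by apply: KM => //; exact: KV.
by rewrite invgM invgK -!mulgA mulVKg.
Qed.

End Image.

(** * Elements close to the identity *)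

Section Estimates.
Variable R : realType.
Local Notation C := (R[i]).

Lemma nsqD_le (x y : C) : nsq (x + y) <= 2 * (nsq x + nsq y).
Proof.
case: x y => a b [c d]; rewrite /nsq /=.
by have := sqr_ge0 (a - c); have := sqr_ge0 (b - d); nra.
Qed.

Lemma nsqB_le (x y : C) : nsq (x - y) <= 2 * (nsq x + nsq y).
Proof. by rewrite -(nsqN y); exact: nsqD_le. Qed.

Lemma nsq1 : nsq (1 : C) = 1. Proof. by rewrite /nsq /= expr0n addr0 expr1n. Qed.

Lemma nsqD3_le (x y z : C) : nsq (x + y + z) <= 4 * (nsq x + nsq y + nsq z).
Proof.
have := nsqD_le (x + y) z; have := nsqD_le x y; have := nsq_ge0 z; lra.
Qed.

Lemma nsq_mulmx (M N : 'M[C]_3) (s t : R) i j :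
  (forall i j, nsq (M i j) <= s) -> (forall i j, nsq (N i j) <= t) ->
  nsq ((M *m N) i j) <= 12 * s * t.
Proof.
move=> hM hN; rewrite mxE sum3E; apply: le_trans (nsqD3_le _ _ _) _.
have H k : nsq (M i k * N k j) <= s * t.
  by rewrite nsqM; apply: ler_pM => //; exact: nsq_ge0.
by have := H 0; have := H 1; have := H 2; lra.
Qed.

(** With indices modulo 3 the cofactors need no signs. *)
Lemma inv3E (M : SL R 3) i j : invmx (SLval M) i j =
  SLval M (j + 1) (i + 1) * SLval M (j + 2) (i + 2)
  - SLval M (j + 1) (i + 2) * SLval M (j + 2) (i + 1).
Proof.
pose A : 'M[C]_3 := \matrix_(i, j) (SLval M (j + 1) (i + 1) * SLval M (j + 2) (i + 2)
  - SLval M (j + 1) (i + 2) * SLval M (j + 2) (i + 1)).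
suff -> : invmx (SLval M) = A by rewrite mxE.
apply: (can_inj (mulmxK (SL_unit M))); rewrite mulVmx ?SL_unit //.
have d := eqP (SL_det M); rewrite det3E in d.
have a11 : 1 + 1 = 2 :> 'I_3 by exact: val_inj.
have a12 : 1 + 2 = 0 :> 'I_3 by exact: val_inj.
have a21 : 2 + 1 = 0 :> 'I_3 by exact: val_inj.
have a22 : 2 + 2 = 1 :> 'I_3 by exact: val_inj.
apply/matrixP => k l; rewrite !mxE sum3E !mxE !add0r a11 a12 a21 a22.
by move: k l; do 2 apply: forall3; rewrite ?add0r ?a11 ?a12 ?a21 ?a22 /= ?mulr1n ?mulr0n -?d; ring.
Qed.

Lemma nsq_inv (M : SL R 3) (s : R) i j : (forall i j, nsq (SLval M i j) <= s) ->
  nsq (invmx (SLval M) i j) <= 4 * s ^+ 2.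
Proof.
move=> hM; rewrite inv3E; apply: le_trans (nsqB_le _ _) _.
have H a b c d : nsq (SLval M a b * SLval M c d) <= s ^+ 2.
  by rewrite nsqM expr2; apply: ler_pM => //; exact: nsq_ge0.
set u := nsq _; set v := nsq _.
have : u <= s ^+ 2 by exact: H.
have : v <= s ^+ 2 by exact: H.
lra.
Qed.

(** M N^-1 - 1 = (M - N) N^-1. *)
Lemma nsq_ratio (M N : SL R 3) (s t : R) i j :
  (forall i j, nsq (SLval N i j) <= s) -> SLball N t M ->
  nsq (SLval (M * N^-1)%g i j - (i == j)%:R) <= 48 * t * s ^+ 2.
Proof.
move=> hN hM.
rewrite (_ : _ - _ = ((SLval M - SLval N) *m invmx (SLval N)) i j); last first.
  by rewrite mulmxBl mulmxV ?SL_unit //= -/(invmx _); move: (SLval M *m _) => A; rewrite !mxE.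
rewrite (_ : 48 * t * s ^+ 2 = 12 * t * (4 * s ^+ 2)); last by ring.
apply: nsq_mulmx => k l; last exact: nsq_inv.
by rewrite !mxE; apply/ltW/hM.
Qed.
End Estimates.

Section Separation.
Variables (R : realType) (omega r : R[i]).
Hypothesis homega : 3.-primitive_root omega.
Hypothesis hr : r ^+ 3 = 1 - omega.
Local Notation C := (R[i]).
Local Notation O := (Zadjoin omega).
Local Notation P := (PSL_over (n := 3) O).
Local Notation lam := (lam omega).
Variable b : PSL R 3.
Hypothesis hb : PSL_class_of (mxB omega r) b.

(** Any positive value below 1 / (100 * 81^2) would do. *)
Definition sep_radius : R := (10 ^+ 6)^-1.

(** The cube of the denominator of a representative of b^-1. *)
Let D : C := lam * (omega + 2) ^+ 3.

Lemma omega2E : omega + 2 = 2%:~R + 1%:~R * omega.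
Proof. by ring. Qed.

Lemma bV_entries : exists B : SL R 3, [/\ b^-1%g = PSL_class B &
  exists2 d, d ^+ 3 * D = 1 & exists2 A : 'M[C]_3, SLval B = d *: A & forall i j, O (A i j)].
Proof.
have [M ME bM] := hb.
exists (M^-1)%g; split; first by rewrite bM PSL_classV.
have w2 : omega + 2 != 0.
  by rewrite -nsq_eq0 omega2E nsq_O // intr_eq0.
have r0 : r != 0 := r_neq0 homega hr.
exists (r * (omega + 2))^-1.
  rewrite /D /lam -hr; field.
  by rewrite r0 w2.
exists (toM omega exB'); last by move=> i j; rewrite mxE; exact: eC_O.
apply: (can_inj (mulKmx (SL_unit M))); rewrite /= mulmxV ?SL_unit // ME mxB_toM.
rewrite -scalemxAl -scalemxAr scalerA -toM_mul //.
rewrite (_ : emx_mul exB exB' = emx_scal (6, 3) emx1); last by vm_compute.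
rewrite toM_scal // toM1 scalerA (_ : _ * _ = 1) ?scale1r //.
by rewrite /eC /= !zCE; field; rewrite r0 w2.
Qed.

Lemma nsq_D : nsq D = 81.
Proof.
rewrite nsqM nsq_exp nsq_lam // omega2E nsq_O //.
have -> : (2 ^+ 2 - 2 * 1 + 1 ^+ 2 : int)%:~R = 3 :> R by [].
by ring.
Qed.

Lemma cube_close (z : C) : nsq (z - 1) < sep_radius -> nsq (z ^+ 3 - 1) < (6561)^-1.
Proof.
move=> hz.
have e1 : sep_radius <= 1 by rewrite /sep_radius invf_le1 ?exprn_gt0 // exprn_ege1 // ler1n.
have z4 : nsq z <= 4.
  by have := nsqD_le (z - 1) 1; rewrite subrK nsq1; lra.
have h : nsq (z ^+ 2 + z + 1) <= 100.
  have := nsqD3_le (z ^+ 2) z 1; rewrite nsq1 nsq_exp; have := nsq_ge0 z; nra.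
rewrite (_ : z ^+ 3 - 1 = (z - 1) * (z ^+ 2 + z + 1)); last by ring.
rewrite nsqM.
apply: (@le_lt_trans _ _ (sep_radius * 100)).
  by apply: ler_pM => //; [exact: nsq_ge0|exact: nsq_ge0|exact: ltW].
by rewrite /sep_radius; lra.
Qed.

(** y^3 would be an element of O close to D^n, hence equal to it; but the
    squared modulus 81^n of D^n is not a cube for n = 1, 2. *)
Lemma no_cube (z y : C) n : (0 < n < 3)%N -> O y -> nsq (z - 1) < sep_radius ->
  z ^+ 3 * D ^+ n <> y ^+ 3.
Proof.
move=> n3 Oy hz e.
have OD' : O D.
  apply: O_mul; first exact: O_lam.
  by apply: O_exp => //; apply: O_add; [exact: O_omega|exact: (O_nat homega 2)].
have Dle : nsq (D ^+ n) <= 6561.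
  rewrite nsq_exp nsq_D; case: n n3 {e} => [|[|[|]]] // _; lra.
have dz : y ^+ 3 - D ^+ n = 0.
  apply/eqP/negP => /negP nz.
  have Od : O (y ^+ 3 - D ^+ n) by apply: O_sub => //; apply: O_exp.
  have := O_nsq_ge1 homega Od nz; apply/negP; rewrite -ltNge.
  rewrite -e (_ : _ - _ = (z ^+ 3 - 1) * D ^+ n); last by ring.
  rewrite nsqM; have := cube_close hz; have := nsq_ge0 (z ^+ 3 - 1); nra.
have [m mE] := O_nsq homega Oy.
have : nsq (y ^+ 3) = nsq (D ^+ n) by congr nsq; apply/eqP; rewrite -subr_eq0 dz.
rewrite !nsq_exp mE nsq_D -!natrX => /eqP; rewrite eqr_nat => /eqP.
case: n n3 {e Dle dz} => [|[|[|]]] // _; rewrite ?expn1.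
  by case: m {mE} => [|[|[|[|[|m]]]]] //; rewrite !expnS; lia.
have [ml|ml] := ltnP m 19; last first.
  have : (19 ^ 3 <= m ^ 3)%N by rewrite leq_exp2r.
  by move=> h1 h2; move: h1; rewrite h2.
by move: m ml {mE}; do 19 (case=> //).
Qed.

(** Let the class of M be in P b^-n. For n = 1, 2 the corner entry of M
    contradicts [no_cube]. For n = 0 the matrix M is an integral matrix times
    a root of unity, and the off-diagonal entries of that matrix and the
    differences of its diagonal entries have modulus less than 1, so they
    vanish. *)
Lemma separation (M : SL R 3) :
  (exists2 n, (n < 3)%N & P (PSL_class M * b ^+ n)%g) ->
  (forall i j, nsq (SLval M i j - (i == j)%:R) < sep_radius) -> PSL_class M = 1%g.
Proof.
move=> [n n3 [N /= hN NE]] hM.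
have [B [bB [d dD [A BE OA]]]] := bV_entries.
have ME : PSL_class M = PSL_class (N * B ^+ n)%g.
  have BX k : PSL_class (B ^+ k)%g = (b ^- k)%g.
    elim: k => [|k IH]; first by rewrite expg0 invg1.
    by rewrite expgSr -PSL_classM IH -bB expgS invgM.
  by rewrite -PSL_classM NE BX mulgK.
have [c cE] := (PSL_classP _ _).2 ME.
have c3 := SL3_scalar cE.
have h00 := hM 0 0; rewrite eqxx /= mulr1n in h00.
case: n n3 NE ME cE => [|[|[|//]]] _ NE ME cE.
- rewrite expg0 mulg1 in cE.
  have e1 : sep_radius < 1 / 4.
    rewrite /sep_radius; lra.
  have offd i j : i != j -> SLval N i j = 0.
    move=> ij; apply/eqP/negP => /negP nz.
    have := O_nsq_ge1 homega (hN i j) nz; apply/negP; rewrite -ltNge.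
    have := hM i j; rewrite (negPf ij) subr0 cE mxE nsqM (nsq_root1 c3) mul1r.
    lra.
  have diag i : SLval N i i = SLval N 0 0.
    apply/eqP; rewrite -subr_eq0; apply/negP => /negP nz.
    have := O_nsq_ge1 homega (O_sub (hN i i) (hN 0 0)) nz; apply/negP; rewrite -ltNge.
    rewrite -[X in X < _]mul1r -{1}(nsq_root1 c3) -nsqM mulrBr.
    have <- : SLval M i i = c * SLval N i i by rewrite cE mxE.
    have <- : SLval M 0 0 = c * SLval N 0 0 by rewrite cE mxE.
    have := hM i i; rewrite eqxx /= mulr1n => hii.
    have := nsqB_le (SLval M i i - 1) (SLval M 0 0 - 1).
    by rewrite opprB addrA subrK; lra.
  apply/PSL_classP; exists (c * SLval N 0 0); rewrite cE -scalerA; congr (_ *: _).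
  apply/matrixP => i j; rewrite !mxE.
  have [<-|ij] := eqVneq i j; first by rewrite diag mulr1.
  by rewrite mulr0 offd.
- case: (@no_cube (SLval M 0 0) ((SLval N *m A) 0 0) 1%N) => //.
    exact: O_mulmx.
  rewrite expg1 in cE.
  have -> : SLval M 0 0 = c * (d * (SLval N *m A) 0 0).
    by rewrite cE /= BE -scalemxAr !mxE.
  by rewrite !exprMn c3 mul1r expr1 -[d ^+ 3 * _ * _]mulrAC dD mul1r.
- case: (@no_cube (SLval M 0 0) ((SLval N *m (A *m A)) 0 0) 2%N) => //.
    by apply: O_mulmx => //; apply: O_mulmx.
  rewrite expg2 in cE.
  have -> : SLval M 0 0 = c * (d ^+ 2 * (SLval N *m (A *m A)) 0 0).
    have E : SLval (N * (B * B))%g = d ^+ 2 *: (SLval N *m (A *m A)).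
      by rewrite /= BE -scalemxAl -!scalemxAr scalerA.
    by rewrite cE E scalerA [LHS]mxE mulrA.
  move: ((SLval N *m (A *m A)) 0 0) => y.
  rewrite (_ : _ * _ = c ^+ 3 * (d ^+ 3 * D) ^+ 2 * y ^+ 3); last by ring.
  by rewrite c3 dD expr1n !mul1r.
Qed.
End Separation.

(** * Discreteness and a free open cover *)

Section FreeCover.
Variables (R : realType) (L : set (PSL R 3)) (eps : R).
Hypothesis Lsub : is_subgroup L.
Hypothesis eps0 : 0 < eps.
Hypothesis Lsep : forall M : SL R 3, L (PSL_class M) ->
  (forall i j, nsq (SLval M i j - (i == j)%:R) < eps) -> PSL_class M = 1%g.
Local Notation C := (R[i]).

Lemma entry_bound (M : SL R 3) : exists2 s, 0 < s & forall i j, nsq (SLval M i j) <= s.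
Proof.
exists (1 + \sum_i \sum_j nsq (SLval M i j)).
  rewrite ltr_pwDl // sumr_ge0 // => i _; apply: sumr_ge0 => j _; exact: nsq_ge0.
move=> i j; rewrite (bigD1 i) //= (bigD1 j) //=.
have h1 : 0 <= \sum_(j' | j' != j) nsq (SLval M i j').
  by apply: sumr_ge0 => k _; exact: nsq_ge0.
have h2 : 0 <= \sum_(i' | i' != i) \sum_j' nsq (SLval M i' j').
  by apply: sumr_ge0 => k _; apply: sumr_ge0 => l _; exact: nsq_ge0.
lra.
Qed.

Lemma close_eq (M N : SL R 3) (s t : R) : (forall i j, nsq (SLval N i j) <= s) ->
  SLball N t M -> 48 * t * s ^+ 2 < eps -> L (PSL_class M * (PSL_class N)^-1)%g ->
  PSL_class M = PSL_class N.
Proof.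
move=> hs ht lt Lx; apply/divg1_eq; rewrite PSL_classV PSL_classM.
apply: Lsep; first by rewrite -PSL_classM -PSL_classV.
by move=> i j; apply: le_lt_trans lt; exact: nsq_ratio.
Qed.

Lemma small_radius (s : R) : 0 < s -> exists k : nat,
  forall t, 0 <= t -> t <= 4 / k.+1%:R -> t <= 1 /\ 48 * t * s ^+ 2 < eps.
Proof.
move=> s0; pose u := 4 + 192 * s ^+ 2 / eps.
have u0 : 0 <= u by rewrite addr_ge0 // divr_ge0 ?mulr_ge0 ?sqr_ge0 // ltW.
exists (Num.bound u) => t t0 ht.
have hk : u < (Num.bound u).+1%:R.
  by apply: lt_trans (archi_boundP u0) _; rewrite ltr_nat.
have k0 : 0 < (Num.bound u).+1%:R :> R by rewrite ltr0n.
move: ht; rewrite ler_pdivlMr // => ht.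
have tu : t * u <= 4.
  by apply: le_trans ht; rewrite ler_wpM2l // ltW.
have e : t * u = 4 * t + (48 * t * s ^+ 2) * 4 / eps.
  by rewrite /u; field; rewrite gt_eqF.
have p : 0 <= 48 * t * s ^+ 2 * 4 / eps by rewrite divr_ge0 ?mulr_ge0 ?sqr_ge0 // ltW.
split; first by lra.
have [t00|tn0] := eqVneq t 0; first by rewrite t00 mulr0 mul0r.
have tp : 0 < t by rewrite lt_neqAle eq_sym tn0.
have : 48 * t * s ^+ 2 * 4 / eps < 4 by lra.
by rewrite ltr_pdivrMr // => h; lra.
Qed.

Lemma subgroup_discrete : discrete_subset L.
Proof.
case: Lsub => L1 LM LV.
move=> x Lx; split; first by rewrite inE.
rewrite -(PSL_reprK x); set N := PSL_repr x.
have [s s0 hs] := entry_bound N; have [k hk] := small_radius s0.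
have k0 : 0 < 4 / k.+1%:R :> R by rewrite divr_gt0 // ltr0n.
exists (@PSL_class R 3 @` SLball N (4 / k.+1%:R)).
  apply: open_nbhs_nbhs; split; first exact/PSL_class_open/open_SLball.
  by exists N => // i j; rewrite subrr /nsq /= expr0n addr0.
apply/seteqP; split=> [_ [[M NM <-] LM']|_ ->].
  apply: close_eq hs NM _ _; first by case: (hk _ (ltW k0)).
  by apply: (LM) => //; apply: LV; rewrite PSL_reprK.
split; last by rewrite PSL_reprK.
by exists N => // i j; rewrite subrr /nsq /= expr0n addr0.
Qed.

Let ratmx := {ffun 'I_3 * 'I_3 -> rat * rat}.

Let center (q : ratmx) : 'M[C]_3 :=
  \matrix_(i, j) (ratr (q (i, j)).1 +i* ratr (q (i, j)).2)%C.

Lemma rat_approx (z : C) (e : R) : 0 < e ->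
  exists q : rat * rat, nsq (z - (ratr q.1 +i* ratr q.2)%C) < e.
Proof.
move=> e0; pose d := Num.min 1 (e / 2).
have d0 : 0 < d by rewrite lt_min ltr01 divr_gt0.
have ax (x : R) : exists q : rat, (x - ratr q) ^+ 2 < e / 2.
  have xd : x - d < x + d by lra.
  have [q /itvP qx] := rat_in_itvoo xd; exists q.
  have h1 : x - d < ratr q by rewrite qx.
  have h2 : ratr q < x + d by rewrite qx.
  have dd : d * d <= e / 2.
    have : d <= 1 by rewrite ge_min lexx.
    have : d <= e / 2 by rewrite ge_min lexx orbT.
    by nra.
  by nra.
case: z => x y; have [p hp] := ax x; have [q hq] := ax y.
by exists (p, q); rewrite /nsq /=; lra.
Qed.

Let good (V : set (PSL R 3)) := forall x l, L l -> V x -> V (l * x)%g -> l = 1%g.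

(** Balls with rational centres form a countable family; those on which L
    does not act freely are replaced by the empty set. *)
Let free_ball (n : nat) : set (PSL R 3) :=
  if unpickle n is Some (q, k) then
    let W := @PSL_class R 3 @` SLball (center q) (1 / k.+1%:R) in
    W `&` [set _ | good W]
  else set0.

(** If l in L moves a point of a small ball to another point of it, then l is
    close to 1 by [nsq_ratio], hence trivial. *)
Lemma free_cover : exists V : nat -> set (PSL R 3),
  [/\ forall n, open (V n), forall x, exists n, V n x &
      forall n x l, L l -> V n x -> V n (l * x)%g -> l = 1%g].
Proof.
exists free_ball; split.
- move=> n; rewrite /free_ball; case: unpickle => [[q k]|]; last exact: open0.
  set W := image _ _.
  have [g|ng] := pselect (good W).
    rewrite (_ : W `&` _ = W); first exact/PSL_class_open/open_SLball.
    by apply/seteqP; split=> [x []|x hx].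
  by rewrite (_ : W `&` _ = set0); [exact: open0|apply/seteqP; split=> [x []|]].
- move=> x; rewrite -(PSL_reprK x); set M := PSL_repr x.
  have [s s0 hs] := entry_bound M.
  have s20 : 0 < 2 * (s + 1) by lra.
  have [k hk] := small_radius s20.
  have k0 : 0 < 1 / k.+1%:R :> R by rewrite divr_gt0 // ltr0n.
  have [q hq] := choice (fun ij : 'I_3 * 'I_3 => rat_approx (SLval M ij.1 ij.2) k0).
  pose c : ratmx := finfun q.
  have Mc : SLball (center c) (1 / k.+1%:R) M.
    by move=> i j; rewrite mxE ffunE; exact: (hq (i, j)).
  exists (pickle (c, k)); rewrite /free_ball pickleK /=; split; first by exists M.
  move=> _ l Ll [N hN <-] [N' hN' e].
  have close (M1 M2 : SL R 3) : SLball (center c) (1 / k.+1%:R) M1 ->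
      SLball (center c) (1 / k.+1%:R) M2 -> SLball (SLval M2) (4 / k.+1%:R) M1.
    move=> h1 h2 i j; have := h1 i j; have := h2 i j.
    have := nsqB_le (SLval M1 i j - center c i j) (SLval M2 i j - center c i j).
    rewrite opprB addrA subrK (_ : 4 / k.+1%:R = 4 * (1 / k.+1%:R)); last by ring.
    by move: (1 / _) => u; lra.
  have t0 : 0 <= 4 / k.+1%:R :> R by rewrite divr_ge0 // ler0n.
  have [t1 t2] := hk _ t0 (lexx _).
  have hsN i j : nsq (SLval N i j) <= 2 * (s + 1).
    have := close _ _ hN Mc i j; have := hs i j.
    have := nsqD_le (SLval N i j - SLval M i j) (SLval M i j).
    by rewrite subrK; move: (4 / _) t1 => u; lra.
  have : PSL_class N' = PSL_class N.
    apply: close_eq hsN (close _ _ hN' hN) _ _ => //.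
    by rewrite e mulgK.
  rewrite e => e'; apply: (@mulIg _ (PSL_class N)).
  by rewrite e' mul1g.
- move=> n x l; rewrite /free_ball; case: unpickle => [[q k]|//].
  by move=> Ll [hx g] [hlx _]; exact: g hx hlx.
Qed.
End FreeCover.

(** * Reduction theory of Hermitian forms *)

Section HermitianForms.
Variable R : realType.
Local Notation C := (R[i]).
Local Notation Re := (@complex.Re R).
Local Notation Im := (@complex.Im R).
Implicit Types h : 'M[C]_3.

Definition act (e h : 'M[C]_3) : 'M[C]_3 := e *m h *m conjmx e.

(** Let h be the Gram matrix of rows v0, v1, v2. Then al h is the squared
    length of v2 and be h the squared area spanned by v1 and v2.
    Orthogonalising from the last row upwards, h 1 2 / al h is the
    coefficient of v1 along v2, and kk h / be h that of v0 along the second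
    vector. *)
Definition beC h : C := h 1 1 * h 2 2 - h 1 2 * h 2 1.
Definition al h : R := Re (h 2 2).
Definition be h : R := Re (beC h).
Definition kk h : C := h 0 1 * h 2 2 - h 0 2 * h 2 1.

Definition hermitian1 h : Prop :=
  [/\ forall i j, h j i = conjc (h i j), \det h = 1, 0 < al h & 0 < be h].

Lemma gram_act (e g : 'M[C]_3) : gram (e *m g) = act e (gram g).
Proof. exact: gramM. Qed.

Lemma actE e h k l : act e h k l =
  e k 0 * h 0 0 * conjc (e l 0) + e k 1 * h 1 0 * conjc (e l 0) + e k 2 * h 2 0 * conjc (e l 0)
  + (e k 0 * h 0 1 * conjc (e l 1) + e k 1 * h 1 1 * conjc (e l 1) + e k 2 * h 2 1 * conjc (e l 1))
  + (e k 0 * h 0 2 * conjc (e l 2) + e k 1 * h 1 2 * conjc (e l 2) + e k 2 * h 2 2 * conjc (e l 2)).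
Proof. by rewrite /act mxE sum3E !mxE !sum3E !mulrDl. Qed.

Lemma real_conj (z : C) : z = conjc z -> z = (Re z)%:C%C.
Proof. by case: z => a b [] h; congr (_ +i* _)%C; lra. Qed.

Section Fixed.
Variable h : 'M[C]_3.
Hypothesis hh : forall i j, h j i = conjc (h i j).

Lemma alC : h 2 2 = (al h)%:C%C. Proof. exact: real_conj. Qed.
Lemma beCE : beC h = (be h)%:C%C.
Proof.
apply: real_conj; rewrite /beC rmorphB !rmorphM /= -!hh; ring.
Qed.

Lemma h11E : Re (h 1 1) * al h = be h + nsq (h 1 2).
Proof.
apply: (@complexI R); rewrite rmorphM rmorphD /= nsqE -beCE -alC -hh /beC.
by rewrite -(real_conj (hh 1 1)); ring.
Qed.

(** The Desnanot-Jacobi identity for h. *)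
Lemma minor01E : \det h = 1 ->
  Re (h 0 0 * h 2 2 - h 0 2 * h 2 0) * be h = al h + nsq (kk h).
Proof.
move=> d; apply: (@complexI R); rewrite rmorphM rmorphD /= nsqE -beCE -alC.
rewrite -real_conj; last by rewrite rmorphB !rmorphM /= -!hh; ring.
rewrite /kk rmorphB !rmorphM /= -!hh /beC -[X in _ = X + _]mulr1 -d det3E; ring.
Qed.
End Fixed.

Lemma al_gram (M : 'M[C]_3) : al (gram M) = \sum_k nsq (M 2 k).
Proof.
apply: (@complexI R); rewrite rmorph_sum /al gramE /=.
rewrite (eq_bigr (fun k => (nsq (M 2 k))%:C%C)); last by move=> k _; rewrite nsqE.
by rewrite -rmorph_sum.
Qed.

Lemma gram_herm (M : 'M[C]_3) i j : gram M j i = conjc (gram M i j).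
Proof.
rewrite !gramE rmorph_sum; apply: eq_bigr => k _.
by rewrite rmorphM /= conjcK mulrC.
Qed.

Lemma be_gram (M : SL R 3) : be (gram (SLval M)) = \sum_k nsq (invmx (SLval M) k 0).
Proof.
apply: (@complexI R); rewrite -beCE; last exact: gram_herm.
rewrite rmorph_sum /= sum3E !nsqE !inv3E.
have a11 : 1 + 1 = 2 :> 'I_3 by exact: val_inj.
have a12 : 1 + 2 = 0 :> 'I_3 by exact: val_inj.
have a21 : 2 + 1 = 0 :> 'I_3 by exact: val_inj.
have a22 : 2 + 2 = 1 :> 'I_3 by exact: val_inj.
rewrite !add0r a11 a12 a21 a22 !rmorphB !rmorphM /= /beC !gramE !sum3E.
ring.
Qed.

Lemma hermitian1_gram (M : SL R 3) : hermitian1 (gram (SLval M)).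
Proof.
have hh := gram_herm (SLval M).
have d : \det (gram (SLval M)) = 1.
  rewrite det_mulmx (eqP (SL_det M)) mul1r det_tr det_map_mx (eqP (SL_det M)).
  by rewrite rmorph1.
have al0 : 0 < al (gram (SLval M)).
  rewrite lt_neqAle al_gram sumr_ge0 ?andbT; last by move=> k _; exact: nsq_ge0.
  apply/eqP => /esym/eqP; rewrite psumr_eq0; last by move=> k _; exact: nsq_ge0.
  move=> /allP z; have {}z k : SLval M 2 k = 0.
    by apply/eqP; rewrite -nsq_eq0; apply: z; rewrite mem_index_enum.
  have /eqP := SL_det M; rewrite det3E !z !mulr0 !subr0 !mulr0 subr0 addr0.
  by move=> /eqP; rewrite eq_sym oner_eq0.
split=> //; rewrite lt_neqAle be_gram sumr_ge0 ?andbT; last by move=> k _; exact: nsq_ge0.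
rewrite -be_gram; apply/eqP => be0.
have := minor01E hh d; rewrite -be0 mulr0.
by have := nsq_ge0 (kk (gram (SLval M))); lra.
Qed.

Definition simp01 := (mulr0n (1 : C), mulr1n (1 : C), @mulr0 C, @mul0r C, @addr0 C,
  @add0r C, @mulr1 C, @mul1r C, conjc0 R, conjc1 R).

Section ElementaryAction.
Variable h : 'M[C]_3.
Hypothesis hh : forall i j, h j i = conjc (h i j).

Variable q : C.

(** Adding a multiple of a row to a row above it preserves al and be, and
    translates one orthogonalisation coefficient. *)
Lemma act12 : let h' := act (elmx 1 2 q) h in
  [/\ al h' = al h, be h' = be h, h' 1 2 = h 1 2 + q * (al h)%:C%C & kk h' = kk h].
Proof.
rewrite /=; have E i j := actE (elmx 1 2 q) h i j.
have m i j : elmx 1 2 q i j = (i == j)%:R + q * ((i == 1) && (j == 2))%:R by rewrite !mxE.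
split.
- by rewrite /al E !m /= !simp01.
- by rewrite /be /beC !E !m /= !simp01; congr complex.Re; ring.
- by rewrite -alC // E !m /= !simp01; ring.
- by rewrite /kk !E !m /= !simp01; ring.
Qed.

Lemma act01 : let h' := act (elmx 0 1 q) h in
  [/\ al h' = al h, be h' = be h, h' 1 2 = h 1 2 & kk h' = kk h + q * (be h)%:C%C].
Proof.
rewrite /=; have E i j := actE (elmx 0 1 q) h i j.
have m i j : elmx 0 1 q i j = (i == j)%:R + q * ((i == 0) && (j == 1))%:R by rewrite !mxE.
split.
- by rewrite /al E !m /= !simp01.
- by rewrite /be /beC !E !m /= !simp01; congr complex.Re; ring.
- by rewrite E !m /= !simp01.
- by rewrite -beCE // /beC /kk !E !m /= !simp01; ring.
Qed.

Lemma act02 : let h' := act (elmx 0 2 q) h in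
  [/\ al h' = al h, be h' = be h, h' 1 2 = h 1 2, kk h' = kk h &
      h' 0 2 = h 0 2 + q * (al h)%:C%C].
Proof.
rewrite /=; have E i j := actE (elmx 0 2 q) h i j.
have m i j : elmx 0 2 q i j = (i == j)%:R + q * ((i == 0) && (j == 2))%:R by rewrite !mxE.
split.
- by rewrite /al E !m /= !simp01.
- by rewrite /be /beC !E !m /= !simp01.
- by rewrite E !m /= !simp01.
- by rewrite /kk !E !m /= !simp01; ring.
- by rewrite -alC // E !m /= !simp01.
Qed.

End ElementaryAction.

(** The sign makes the determinant 1. *)
Definition swap12 : 'M[C]_3 := mx3 [:: [:: 1; 0; 0]; [:: 0; 0; -1]; [:: 0; 1; 0]].
Definition swap01 : 'M[C]_3 := mx3 [:: [:: 0; -1; 0]; [:: 1; 0; 0]; [:: 0; 0; 1]].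

Lemma det_swap12 : \det swap12 = 1.
Proof. by rewrite det3E !mxE /=; ring. Qed.
Lemma det_swap01 : \det swap01 = 1.
Proof. by rewrite det3E !mxE /=; ring. Qed.

Lemma act_swap12 h : al (act swap12 h) = Re (h 1 1) /\ be (act swap12 h) = be h.
Proof.
have E i j := actE swap12 h i j.
have m i j : swap12 i j =
    nth 0 (nth [::] [:: [:: 1; 0; 0]; [:: 0; 0; -1]; [:: 0; 1; 0]] i) j by rewrite !mxE.
have c i j : conjc (swap12 i j) = swap12 i j.
  have c1 : conjc (-1 : C) = -1 := rmorphN1 _.
  by rewrite m (lock (@conjc R)); move: i j; do 2 apply: forall3;
    rewrite /= -lock ?c1 ?conjc0 ?conjc1.
split; first by rewrite /al E !c !m /= !simp01.
by rewrite /be /beC !E !c !m /= !simp01; congr complex.Re; ring.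
Qed.

Lemma act_swap01 h : al (act swap01 h) = al h /\
  be (act swap01 h) = Re (h 0 0 * h 2 2 - h 0 2 * h 2 0).
Proof.
have E i j := actE swap01 h i j.
have m i j : swap01 i j =
    nth 0 (nth [::] [:: [:: 0; -1; 0]; [:: 1; 0; 0]; [:: 0; 0; 1]] i) j by rewrite !mxE.
have c i j : conjc (swap01 i j) = swap01 i j.
  have c1 : conjc (-1 : C) = -1 := rmorphN1 _.
  by rewrite m (lock (@conjc R)); move: i j; do 2 apply: forall3;
    rewrite /= -lock ?c1 ?conjc0 ?conjc1.
split; first by rewrite /al E !c !m /= !simp01.
by rewrite /be /beC !E !c !m /= !simp01; congr complex.Re; ring.
Qed.

Lemma act_diag (u : 'I_3 -> R) h i j :
  act (diag_mx (\row_k (u k)%:C%C)) h i j = (u i * u j)%:C%C * h i j.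
Proof.
rewrite /act mul_diag_mx mxE (bigD1 j) //= big1 => [|k kj]; last first.
  by rewrite !mxE eq_sym (negPf kj) mulr0n conjc0 mulr0.
by rewrite !mxE eqxx mulr1n addr0 conjc_real rmorphM; ring.
Qed.

End HermitianForms.

Lemma five_sixths (F : realFieldType) (m d x : F) :
  d < m + m / 5 -> m <= x -> 5 / 6 * d <= x.
Proof. by lra. Qed.

Lemma third_le_five (F : realFieldType) (u : F) : 0 <= u -> u / 3 <= 5 * u.
Proof. by lra. Qed.

(** In the potential a b, an exchange of rows replaces the factor a by x. If
    this cannot gain more than a factor 5/6, then b is at least (5/6 - 1/3)
    a^2. *)
Lemma swap_gain (F : realFieldType) (a b n x : F) : 0 < a -> 0 < b ->
  n <= a ^+ 2 / 3 -> x * a = b + n -> 5 / 6 * (a * b) <= x * b -> a ^+ 2 <= 2 * b.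
Proof.
move=> a0 b0 hn e; rewrite mulrA ler_pM2r // => h.
have : 5 / 6 * a * a <= x * a by rewrite ler_pM2r.
by rewrite e; lra.
Qed.

Section Reduction.
Variables (R : realType) (omega : R[i]).
Hypothesis homega : 3.-primitive_root omega.
Local Notation C := (R[i]).
Local Notation O := (Zadjoin omega).
Local Notation Re := (@complex.Re R).

Definition SLO : set (SL R 3) := [set M | forall i j, O (SLval M i j)].

(** The orthogonalised rows have squared lengths 1 / be, be / al and al when
    det h = 1. The first two conditions say that their successive quotients
    are at least 1/2. *)
Definition siegel (h : 'M[C]_3) : Prop :=
  [/\ al h ^+ 2 <= 2 * be h, be h ^+ 2 <= 2 * al h,
      al h <= Re (h 1 2) < 2 * al h, be h <= Re (kk h) < 2 * be h &
      [/\ nsq (h 1 2) <= 5 * al h ^+ 2, nsq (kk h) <= 5 * be h ^+ 2 &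
          nsq (h 0 2) <= 5 * al h ^+ 2]].

(** The last row of M and the first column of M^-1 are nonzero vectors over
    O, so their lengths are at least 1; al and be are the squared lengths of
    their images under fixed invertible matrices. *)
Lemma potential_lower (g : SL R 3) : exists2 c : R, 0 < c &
  forall M, SLO M -> c <= al (gram (SLval (M * g)%g)) * be (gram (SLval (M * g)%g)).
Proof.
have [s s0 hs] := entry_bound g; have [t t0 ht] := entry_bound (g^-1)%g.
have le1 (u : R) (F : 'I_3 -> R) (x : C) : 0 < u -> O x -> x != 0 ->
   nsq x <= 4 * (\sum_k F k * u) -> (4 * u)^-1 <= \sum_k F k.
  move=> u0 Ox x0; rewrite -mulr_suml => hx.
  rewrite invf_ple ?posrE ?mulr_gt0 //; last first.
    have := O_nsq_ge1 homega Ox x0; rewrite -(pmulr_lgt0 _ u0); lra.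
  have S0 : 0 < \sum_k F k.
    have := O_nsq_ge1 homega Ox x0; rewrite -(pmulr_lgt0 _ u0); lra.
  rewrite -[X in X <= _]mul1r ler_pdivrMr //.
  by have := O_nsq_ge1 homega Ox x0; lra.
exists ((4 * t)^-1 * (4 * s)^-1); first by rewrite mulr_gt0 // invr_gt0 mulr_gt0.
move=> M OM'.
have [t4 s4] : 0 <= (4 * t)^-1 /\ 0 <= (4 * s)^-1 by rewrite !invr_ge0 !mulr_ge0 // ltW.
apply: (ler_pM t4 s4).
  have [k nz] : exists k, SLval M 2 k != 0.
    apply/not_existsP => z; have {}z k : SLval M 2 k = 0 by apply/eqP/negP => /negP/z.
    have /eqP := SL_det M; rewrite det3E !z !mulr0 !subr0 !mulr0 subr0 addr0.
    by move=> /eqP; rewrite eq_sym oner_eq0.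
  rewrite al_gram; apply: (le1 _ (fun k => nsq (SLval (M * g)%g 2 k)) _ t0 (OM' 2 k) nz).
  have -> : SLval M = SLval (M * g)%g *m SLval (g^-1)%g by rewrite /= mulmxK ?SL_unit.
  rewrite mxE sum3E; apply: le_trans (nsqD3_le _ _ _) _.
  rewrite ler_pM2l // sum3E !nsqM.
  by do 2?[apply: lerD]; apply: ler_wpM2l => //; exact: nsq_ge0.
have OI := O_inv homega OM'.
have [k nz] : exists k, invmx (SLval M) k 0 != 0.
  apply/not_existsP => z; have {}z k : invmx (SLval M) k 0 = 0 by apply/eqP/negP => /negP/z.
  have := mulmxV (SL_unit M) => /matrixP/(_ 0 0); rewrite !mxE sum3E !z !mulr0 !addr0.
  by move=> /eqP; rewrite eq_sym oner_eq0.
rewrite be_gram; apply: (le1 _ (fun k => nsq (invmx (SLval (M * g)%g) k 0)) _ s0 (OI k 0) nz).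
have -> : invmx (SLval M) = SLval g *m invmx (SLval (M * g)%g).
  apply: (can_inj (mulKmx (SL_unit M))); rewrite mulmxV ?SL_unit //.
  by rewrite mulmxA -[SLval M *m SLval g]/(SLval (M * g)%g) mulmxV ?SL_unit.
rewrite mxE sum3E; apply: le_trans (nsqD3_le _ _ _) _.
rewrite ler_pM2l // sum3E !nsqM ![_ * s]mulrC.
by do 2?[apply: lerD]; apply: ler_wpM2r => //; exact: nsq_ge0.
Qed.

Lemma SLO_M M N : SLO M -> SLO N -> SLO (M * N)%g.
Proof. by move=> hM hN; exact: O_mulmx. Qed.

Lemma SLO_el i j q : i != j -> O q -> exists2 M : SL R 3, SLO M & SLval M = elmx i j q.
Proof.
move=> ij Oq; exists (MkSL (introT eqP (det_elmx q ij))) => // k l.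
by rewrite /= !mxE; apply: O_add; [exact: O_nat|apply: O_mul => //; exact: O_nat].
Qed.

Lemma SLO_swap12 : exists2 M : SL R 3, SLO M & SLval M = swap12 R.
Proof.
exists (MkSL (introT eqP (det_swap12 R))) => // k l; rewrite /= mxE.
have O1 := O_1 homega; have O0 := O_0 homega; have ON1 := O_opp O1.
by move: k l; do 2 apply: forall3.
Qed.

Lemma SLO_swap01 : exists2 M : SL R 3, SLO M & SLval M = swap01 R.
Proof.
exists (MkSL (introT eqP (det_swap01 R))) => // k l; rewrite /= mxE.
have O1 := O_1 homega; have O0 := O_0 homega; have ON1 := O_opp O1.
by move: k l; do 2 apply: forall3.
Qed.

Let D (M : SL R 3) : R := al (gram (SLval M)) * be (gram (SLval M)).

(** The infimum over the orbit is positive by [potential_lower], so some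
    element comes within a factor 6/5 of it. *)
Lemma near_min g : exists2 M, SLO M & forall N, SLO N -> 5 / 6 * D (M * g)%g <= D (N * g)%g.
Proof.
have [c c0 hc] := potential_lower g.
pose S := [set D (M * g)%g | M in SLO].
have SLO1 : SLO 1%g by move=> i j; rewrite /= mxE; exact: O_nat.
have lbS : lbound S c by move=> _ [M hM <-]; exact: hc.
have iS : has_inf S by split; [exists (D (1 * g)%g), 1%g|exists c].
have m0 : 0 < inf S by apply: lt_le_trans c0 _; apply: lb_le_inf => //; case: iS.
have e0 : 0 < inf S / 5 by rewrite divr_gt0.
have [_ [M hM <-] hlt] := inf_adherent e0 iS.
exists M => // N hN.
apply: five_sixths hlt _.
by apply: ge_inf; [case: iS|exists N].
Qed.

Lemma round_div (z : C) (u : R) : 0 < u -> exists2 q, O q & nsq (z + q * u%:C%C) <= u ^+ 2 / 3.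
Proof.
move=> u0; have nu : nsq (u%:C%C : C) = u ^+ 2 by rewrite /nsq /= expr0n addr0.
have uC : u%:C%C != 0 :> C by rewrite -nsq_eq0 nu sqrf_eq0 gt_eqF.
have [q Oq hq] := O_round homega (z / u%:C%C).
exists (- q); first exact: O_opp.
rewrite (_ : z + _ = u%:C%C * (z / u%:C%C - q)); last by field.
by rewrite nsqM nu; have := sqr_ge0 u; nra.
Qed.

Lemma round_div_Re (z : C) (u : R) : 0 < u ->
  exists2 q, O q & (u <= Re (z + q * u%:C%C) < 2 * u) && (nsq (z + q * u%:C%C) <= 5 * u ^+ 2).
Proof.
move=> u0; have nu : nsq (u%:C%C : C) = u ^+ 2 by rewrite /nsq /= expr0n addr0.
have uC : u%:C%C != 0 :> C by rewrite -nsq_eq0 nu sqrf_eq0 gt_eqF.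
have [q Oq /andP[/andP[h1 h2] h3]] := O_round_Re homega (z / u%:C%C).
exists q => //.
rewrite (_ : z + _ = u%:C%C * (z / u%:C%C + q)); last by field.
rewrite nsqM nu; move: h1 h2 h3; set w := z / _ + q => h1 h2 h3.
have -> : Re (u%:C%C * w) = u * Re w by case: w {h1 h2 h3} => x y /=; ring.
apply/andP; split; last by have := sqr_ge0 u; nra.
by apply/andP; split; nra.
Qed.

(** As in lattice basis reduction: when the potential al * be is almost
    minimal on the orbit, exchanging two consecutive rows after a size
    reduction gains little, which gives the lower bounds on the quotients of
    lengths. Translations by elements of O then bring the coefficients into
    their boxes. *)
Theorem siegel_reduction (g : SL R 3) : exists2 M, SLO M & siegel (gram (SLval (M * g)%g)).
Proof.
have [M0 O0 min0] := near_min g.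
pose orbit h := exists2 M, SLO M & h = gram (SLval (M * g)%g).
have orb_act e h : (exists2 N : SL R 3, SLO N & SLval N = e) -> orbit h -> orbit (act e h).
  move=> [N ON' <-] [M OM' ->]; exists (N * M)%g; first exact: SLO_M.
  by rewrite -gram_act -mulgA.
have orb_el i j q h : i != j -> O q -> orbit h -> orbit (act (elmx i j q) h).
  by move=> ij Oq; apply: orb_act; exact: SLO_el.
have orb_h h : orbit h -> hermitian1 h by move=> [M _ ->]; exact: hermitian1_gram.
pose a := al (gram (SLval (M0 * g)%g)); pose b := be (gram (SLval (M0 * g)%g)).
have mina h : orbit h -> 5 / 6 * (a * b) <= al h * be h.
  by move=> [M OM' ->]; exact: min0.
have orb0 : orbit (gram (SLval (M0 * g)%g)) by exists M0.
move: (gram _) orb0 @a @b mina => h0 orb0 a b mina.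
have [hh0 d0 a0 b0] := orb_h _ orb0.
(* Size-reduce the middle row, then exchange it with the last one. *)
have [q1 Oq1 hq1] := round_div (h0 1 2) a0.
have orb1 := orb_el 1 2 q1 h0 isT Oq1 orb0.
have [al1 be1 p1 k1] := act12 hh0 q1.
set h1 := act _ h0 in orb1 al1 be1 p1 k1.
have [hh1 d1 a1 b1] := orb_h _ orb1.
have ab : a ^+ 2 <= 2 * b.
  have hm := mina _ (orb_act _ _ SLO_swap12 orb1).
  have [e1 e2] := act_swap12 h1; rewrite e1 e2 be1 in hm.
  have e := h11E hh1; rewrite al1 be1 p1 in e.
  exact: (swap_gain a0 b0 hq1 e hm).
(* Size-reduce the first row, then exchange it with the middle one. *)
have [q2 Oq2 hq2] := round_div (kk h1) b1.
have orb2 := orb_el 0 1 q2 h1 isT Oq2 orb1.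
have [al2 be2 p2 k2] := act01 hh1 q2.
set h2 := act _ h1 in orb2 al2 be2 p2 k2.
have [hh2 d2 a2 b2] := orb_h _ orb2.
have ba : b ^+ 2 <= 2 * a.
  have hm := mina _ (orb_act _ _ SLO_swap01 orb2).
  have [e1 e2] := act_swap01 h2; rewrite e1 e2 al2 al1 in hm.
  have e := minor01E hh2 d2; rewrite al2 be2 k2 al1 be1 in e; rewrite be1 in hq2.
  apply: (swap_gain b0 a0 hq2 e).
  by rewrite [_ * al _]mulrC [X in _ <= X]mulrC.
(* From here on al and be do not change. *)
have [q3 Oq3 /andP[hp hp']] := round_div_Re (h2 1 2) a2.
have orb3 := orb_el 1 2 q3 h2 isT Oq3 orb2.
have [al3 be3 p3 k3] := act12 hh2 q3.
set h3 := act _ h2 in orb3 al3 be3 p3 k3.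
have [hh3 d3 a3 b3] := orb_h _ orb3.
have [q4 Oq4 /andP[hk hk']] := round_div_Re (kk h3) b3.
have orb4 := orb_el 0 1 q4 h3 isT Oq4 orb3.
have [al4 be4 p4 k4] := act01 hh3 q4.
set h4 := act _ h3 in orb4 al4 be4 p4 k4.
have [hh4 d4 a4 b4] := orb_h _ orb4.
have [q5 Oq5 hs] := round_div (h4 0 2) a4.
have orb5 := orb_el 0 2 q5 h4 isT Oq5 orb4.
have [al5 be5 p5 k5 s5] := act02 hh4 q5.
set h5 := act _ h4 in orb5 al5 be5 p5 k5 s5.
have [M OM' E] := orb5; exists M; [exact: OM'|rewrite -E].
have a2E : al h2 = a by rewrite al2 al1.
have b3E : be h3 = b by rewrite be3 be2 be1.
have a4E : al h4 = a by rewrite al4 al3.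
have aE : al h5 = a by rewrite al5.
have bE : be h5 = b by rewrite be5 be4.
rewrite -p3 -p4 -p5 a2E -aE in hp hp'; rewrite -k4 -k5 b3E -bE in hk hk'.
rewrite -s5 a4E -aE in hs.
rewrite -aE -bE in ab ba.
split; [exact: ab|exact: ba|exact: hp|exact: hk|split; [exact: hp'|exact: hk'|]].
exact: (le_trans hs (third_le_five (sqr_ge0 _))).
Qed.
End Reduction.

(** * The measure of the Siegel set *)

(** The quotients of the three squared lengths are bounded and their product
    is 1, so the lengths are bounded, and with them the diagonal of the Gram
    matrix. *)
Lemma size_bound (F : realFieldType) (a b p k s x y : F) :
  0 < a -> 0 < b -> a ^+ 2 <= 2 * b -> 2 * b < a ^+ 2 * 64 ->
  b ^+ 2 <= 2 * a -> 2 * a < b ^+ 2 * 64 ->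
  p <= 5 * a ^+ 2 -> k <= 5 * b ^+ 2 -> s <= 5 * a ^+ 2 ->
  y * a = b + p -> (x * a - s) * b = a + k ->
  [/\ a <= 2, y <= 2400 & x <= 2400].
Proof.
move=> a0 b0 h1 h2 h3 h4 hp hk hs ey ex.
have a2 : a <= 2.
  rewrite leNgt; apply/negP => a2.
  have : 2 * a < a ^+ 2 by nra.
  move=> h; have ab : a < b by nra.
  have : a * a < b ^+ 2 by nra.
  nra.
have b2 : b <= 2.
  rewrite leNgt; apply/negP => b2; have : b < a by nra.
  lra.
have y1 : y <= 37 * a.
  by rewrite -(ler_pM2r a0) ey; nra.
have x1 : x * a - s <= 37 * b.
  by rewrite -(ler_pM2r b0) ex; nra.
have x2 : x <= 1189 * a.
  rewrite -(ler_pM2r a0); apply: (@le_trans _ _ (37 * b + s)); first by lra.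
  by nra.
by split=> //; lra.
Qed.

Section SiegelMeasure.
Variable R : realType.
Local Notation C := (R[i]).
Local Notation Re := (@complex.Re R).
Local Notation G := (PSL R 3).
Implicit Types h : 'M[C]_3.

Lemma power_bracket (A B : R) : 0 < A -> A <= B ->
  exists n, A * 64 ^+ n <= B < A * 64 ^+ n.+1.
Proof.
move=> A0 AB.
have ex : exists n : nat, B < A * 64 ^+ n.
  have B0 : 0 <= B / A by rewrite divr_ge0 ?ltW // (lt_le_trans A0).
  exists (Num.bound (B / A)); rewrite mulrC -ltr_pdivrMr //.
  apply: lt_trans (archi_boundP B0) _.
  by rewrite -natrX ltr_nat ltn_expl.
case: (ex_minnP ex) => -[|n] hn nmin; first by move: hn; rewrite expr0 mulr1 ltNge AB.
exists n; rewrite hn andbT leNgt; apply/negP => /nmin; by rewrite ltnn.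
Qed.

Lemma dyadic_unique (t u : R) n m : 0 < u ->
  u <= t * 8 ^+ n < 2 * u -> u <= t * 8 ^+ m < 2 * u -> n = m.
Proof.
move=> u0; wlog nm : n m / (n <= m)%N.
  by move=> H h1 h2; case/orP: (leq_total n m) => nm; [exact: H|apply/esym; exact: H].
move=> /andP[h1 h2] /andP[h3 h4]; apply/eqP; rewrite eqn_leq nm /= leqNgt; apply/negP => lt.
have : t * 8 ^+ n * 8 <= t * 8 ^+ m.
  have t0 : 0 < t by rewrite -(pmulr_lgt0 _ (exprn_gt0 n (ltr0n R 8))); exact: lt_le_trans h1.
  by rewrite -mulrA -exprSr ler_pM2l // ler_weXn2l // ler1n.
lra.
Qed.

(** Quotients of squared lengths are measured in powers of 64 = (2^3)^2: the
    cube allows a diagonal matrix of determinant 1 with powers of 2 as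
    entries to undo them. *)
Definition piece (n1 n2 : nat) h : Prop :=
  [/\ siegel h, al h ^+ 2 * 64 ^+ n2 <= 2 * be h < al h ^+ 2 * 64 ^+ n2.+1 &
      be h ^+ 2 * 64 ^+ n1 <= 2 * al h < be h ^+ 2 * 64 ^+ n1.+1].

Lemma siegel_piece h : 0 < al h -> 0 < be h -> siegel h -> exists n1 n2, piece n1 n2 h.
Proof.
move=> a0 b0 s; have [s1 s2 _ _ _] := s.
have [n2 hn2] := power_bracket (exprn_gt0 2 a0) s1.
have [n1 hn1] := power_bracket (exprn_gt0 2 b0) s2.
by exists n1, n2.
Qed.

(** With X = 2^n1 and Y = 2^n2, the quotients of consecutive entries are X^3
    = 8^n1 and Y^3 = 8^n2. *)
Definition diag_coef (n1 n2 : nat) (i : 'I_3) : R :=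
  nth 0 [:: (2 ^+ n1) ^- 2 / 2 ^+ n2; 2 ^+ n1 / 2 ^+ n2; 2 ^+ n1 * (2 ^+ n2) ^+ 2] i.

Lemma det_diag_coef n1 n2 :
  \det (diag_mx (\row_k (diag_coef n1 n2 k)%:C%C) : 'M[C]_3) == 1.
Proof.
rewrite det_diag big_ord_recl !big_ord_recl big_ord0 !mxE /diag_coef /=.
rewrite mulr1 -!rmorphM /=; apply/eqP.
have p n : 2 ^+ n != 0 :> R by rewrite expf_neq0 // pnatr_eq0.
rewrite (_ : _ * _ = 1) ?rmorph1 //; move: (p n1) (p n2).
by move: (2 ^+ n1 : R) (2 ^+ n2 : R) => X Y X0 Y0; field; rewrite X0 Y0.
Qed.

Definition diagSL n1 n2 : SL R 3 := MkSL (det_diag_coef n1 n2).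

(** The quotients of lengths become bounded, while the real parts of the two
    coefficients, which were in [1, 2), go to [1, 2) divided by 8^n2 and by
    8^n1. These intervals are disjoint for different exponents. *)
Lemma act_piece n1 n2 h : 0 < al h -> 0 < be h -> piece n1 n2 h ->
  let h' := act (SLval (diagSL n1 n2)) h in
  [/\ al h' <= Re (h' 1 2) * 8 ^+ n2 < 2 * al h',
      be h' <= Re (kk h') * 8 ^+ n1 < 2 * be h',
      al h' ^+ 2 <= 2 * be h' < al h' ^+ 2 * 64,
      be h' ^+ 2 <= 2 * al h' < be h' ^+ 2 * 64 &
      [/\ nsq (h' 1 2) <= 5 * al h' ^+ 2, nsq (kk h') <= 5 * be h' ^+ 2 &
          nsq (h' 0 2) <= 5 * al h' ^+ 2]].
Proof.
move=> a0 b0 [[s1 s2 /andP[p1 p2] /andP[k1 k2] [pp kp sp]] /andP[y1 y2] /andP[x1 x2]] h'.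
set X : R := 2 ^+ n1; set Y : R := 2 ^+ n2.
have X1 : 1 <= X by rewrite exprn_ege1 // ler1n.
have Y1 : 1 <= Y by rewrite exprn_ege1 // ler1n.
have X0 : 0 < X by lra.
have Y0 : 0 < Y by lra.
have X8 : 8 ^+ n1 = X ^+ 3 by rewrite -exprM mulnC exprM; congr (_ ^+ _); ring.
have Y8 : 8 ^+ n2 = Y ^+ 3 by rewrite -exprM mulnC exprM; congr (_ ^+ _); ring.
have X64 : 64 ^+ n1 = X ^+ 6 by rewrite -exprM mulnC exprM; congr (_ ^+ _); ring.
have Y64 : 64 ^+ n2 = Y ^+ 6 by rewrite -exprM mulnC exprM; congr (_ ^+ _); ring.
rewrite (exprSr (64 : R)) Y64 mulrA in y2; rewrite (exprSr (64 : R)) X64 mulrA in x2.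
rewrite Y64 in y1; rewrite X64 in x1.
have hE i j : h' i j = (diag_coef n1 n2 i * diag_coef n1 n2 j)%:C%C * h i j by exact: act_diag.
have ReZ (c : R) (z : C) : Re (c%:C%C * z) = c * Re z by case: z => x y /=; ring.
have nsqZ (c : R) (z : C) : nsq (c%:C%C * z) = c ^+ 2 * nsq z.
  by rewrite nsqM; congr (_ * _); rewrite /nsq /= expr0n addr0.
have Xn : X != 0 by rewrite gt_eqF.
have Yn : Y != 0 by rewrite gt_eqF.
have u00 : diag_coef n1 n2 0 = X ^- 2 / Y by [].
have u11 : diag_coef n1 n2 1 = X / Y by [].
have u22 : diag_coef n1 n2 2 = X * Y ^+ 2 by [].
have alE : al h' = X ^+ 2 * Y ^+ 4 * al h.
  by rewrite /al hE ReZ u22; ring.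
have pE : h' 1 2 = (X ^+ 2 * Y)%:C%C * h 1 2.
  by rewrite hE u11 u22; congr (_%:C%C * _); field.
have sE : h' 0 2 = (Y / X)%:C%C * h 0 2.
  by rewrite hE u00 u22; congr (_%:C%C * _); field; rewrite ?Xn ?Yn.
have h21E : h' 2 1 = (X ^+ 2 * Y)%:C%C * h 2 1.
  by rewrite hE u11 u22; congr (_%:C%C * _); field.
have h22E : h' 2 2 = (X ^+ 2 * Y ^+ 4)%:C%C * h 2 2.
  by rewrite hE u22; congr (_%:C%C * _); ring.
have beE : be h' = X ^+ 4 * Y ^+ 2 * be h.
  rewrite /be -ReZ /beC pE h21E h22E hE u11; congr (Re _).
  rewrite (_ : (X / Y * (X / Y))%:C%C * h 1 1 * _ =
     ((X / Y * (X / Y)) * (X ^+ 2 * Y ^+ 4))%:C%C * (h 1 1 * h 2 2)); last first.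
    by rewrite rmorphM /=; ring.
  rewrite (_ : X / Y * (X / Y) * (X ^+ 2 * Y ^+ 4) = X ^+ 4 * Y ^+ 2); last by field.
  rewrite mulrBr; congr (_ - _); rewrite mulrACA -rmorphM /=; congr (_%:C%C * _).
  by ring.
have kE : kk h' = (X * Y ^+ 2)%:C%C * kk h.
  rewrite /kk h22E h21E sE hE u00 u11.
  rewrite (_ : (X ^- 2 / Y * (X / Y))%:C%C * h 0 1 * _ =
     ((X ^- 2 / Y * (X / Y)) * (X ^+ 2 * Y ^+ 4))%:C%C * (h 0 1 * h 2 2)); last first.
    by rewrite rmorphM /=; ring.
  rewrite (_ : X ^- 2 / Y * (X / Y) * (X ^+ 2 * Y ^+ 4) = X * Y ^+ 2);
    last by field; rewrite ?Xn ?Yn.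
  rewrite mulrBr; congr (_ - _); rewrite mulrACA -rmorphM /=; congr (_%:C%C * _).
  by field.
have scale (c u v w : R) : 0 < c -> (u <= v < w) -> (c * u <= c * v < c * w).
  by move=> c0; rewrite ler_pM2l // ltr_pM2l.
have grow (c d n A : R) : 0 <= A -> 0 <= c <= d -> n <= 5 * A -> c * n <= 5 * (d * A).
  move=> A0 /andP[c0 cd] nA; apply: (@le_trans _ _ (c * (5 * A))); first exact: ler_wpM2l.
  by rewrite mulrCA ler_pM2l // ler_wpM2r.
have pos n m : 0 < X ^+ n * Y ^+ m by rewrite mulr_gt0 // exprn_gt0.
rewrite alE beE pE kE sE !ReZ !nsqZ X8 Y8.
split.
- rewrite (_ : X ^+ 2 * Y * _ * _ = X ^+ 2 * Y ^+ 4 * Re (h 1 2)); last by ring.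
  by rewrite [2 * (_ * al h)]mulrCA; apply: scale => //; apply/andP.
- rewrite (_ : X * Y ^+ 2 * _ * _ = X ^+ 4 * Y ^+ 2 * Re (kk h)); last by ring.
  by rewrite [2 * (_ * be h)]mulrCA; apply: scale => //; apply/andP.
- rewrite (_ : (_ * al h) ^+ 2 = X ^+ 4 * Y ^+ 2 * (al h ^+ 2 * Y ^+ 6)); last by ring.
  by rewrite [2 * (_ * be h)]mulrCA -[_ * 64]mulrA; apply: scale => //; apply/andP.
- rewrite (_ : (_ * be h) ^+ 2 = X ^+ 2 * Y ^+ 4 * (be h ^+ 2 * X ^+ 6)); last by ring.
  by rewrite [2 * (_ * al h)]mulrCA -[_ * 64]mulrA; apply: scale => //; apply/andP.
have e (n m : nat) (Z : R) : 1 <= Z -> (n <= m)%N -> 0 <= Z ^+ n <= Z ^+ m.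
  by move=> Z1 nm; rewrite exprn_ge0 ?ler_weXn2l //; lra.
have le_mul (a b c d : R) : 0 <= a <= b -> 0 <= c <= d -> 0 <= a * c <= b * d.
  by move=> /andP[? ?] /andP[? ?]; rewrite mulr_ge0 // ler_pM.
split.
- rewrite (_ : (_ * al h) ^+ 2 = X ^+ 4 * Y ^+ 8 * al h ^+ 2); last by ring.
  apply: grow => //; first exact: sqr_ge0.
  rewrite (_ : (X ^+ 2 * Y) ^+ 2 = X ^+ 4 * Y ^+ 2); last by ring.
  by apply: le_mul; exact: e.
- rewrite (_ : (_ * be h) ^+ 2 = X ^+ 8 * Y ^+ 4 * be h ^+ 2); last by ring.
  apply: grow => //; first exact: sqr_ge0.
  rewrite (_ : (X * Y ^+ 2) ^+ 2 = X ^+ 2 * Y ^+ 4); last by ring.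
  by apply: le_mul; exact: e.
- rewrite (_ : (_ * al h) ^+ 2 = X ^+ 4 * Y ^+ 8 * al h ^+ 2); last by ring.
  apply: grow => //; first exact: sqr_ge0.
  rewrite (_ : (Y / X) ^+ 2 = X^-1 ^+ 2 * Y ^+ 2); last by field.
  apply: le_mul; last exact: e.
  rewrite sqr_ge0 /=; apply: (@le_trans _ _ 1); last by rewrite exprn_ege1.
  by rewrite exprn_ile1 ?invr_ge0 ?invf_le1 //; lra.
Qed.


Lemma bounded_diag h : hermitian1 h ->
  al h ^+ 2 <= 2 * be h < al h ^+ 2 * 64 -> be h ^+ 2 <= 2 * al h < be h ^+ 2 * 64 ->
  nsq (h 1 2) <= 5 * al h ^+ 2 -> nsq (kk h) <= 5 * be h ^+ 2 -> nsq (h 0 2) <= 5 * al h ^+ 2 ->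
  forall i, Re (h i i) <= 2400.
Proof.
move=> [hh d a0 b0] /andP[h1 h2] /andP[h3 h4] hp hk hs.
have e11 := h11E hh; have e00 := minor01E hh d.
have e00' : Re (h 0 0 * h 2 2 - h 0 2 * h 2 0) = Re (h 0 0) * al h - nsq (h 0 2).
  rewrite (hh 0 2) (alC hh) /nsq.
  by case: (h 0 0) (h 0 2) => x y [z t] /=; ring.
rewrite e00' in e00.
have [a2 y2 x2] := size_bound a0 b0 h1 h2 h3 h4 hp hk hs e11 e00.
by apply: forall3 => //; apply: le_trans a2 _; rewrite ler_nat.
Qed.

Notation mb A := (measurable (A : set (Borel G))).

Lemma measurable_le (f g : G -> R) : continuous f -> continuous g -> mb [set x | f x <= g x].
Proof. by move=> cf cg; apply: closed_Borel; exact: closed_le_cont. Qed.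

Lemma measurable_lt (f g : G -> R) : continuous f -> continuous g -> mb [set x | f x < g x].
Proof.
move=> cf cg; rewrite (_ : [set x | _] = ~` [set x | g x <= f x]).
  by apply: measurableC; exact: measurable_le.
by apply/seteqP; split=> x /=; rewrite ltNge => /negP.
Qed.

Lemma measurable_lelt (f g h : G -> R) : continuous f -> continuous g -> continuous h ->
  mb [set x | f x <= g x < h x].
Proof.
move=> cf cg ch; rewrite (_ : [set x | _] = [set x | f x <= g x] `&` [set x | g x < h x]).
  by apply: measurableI; [exact: measurable_le|exact: measurable_lt].
by apply/seteqP; split=> x /=; [move=> /andP|move=> ?; apply/andP].
Qed.

Lemma al_cont : continuous (fun x : G => al (PSLgram x)).
Proof. exact: (@PSLgram_cont R 2 2).1. Qed.

Lemma be_ccont : ccont (fun x : G => beC (PSLgram x)).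
Proof.
apply: ccontD; first by apply: ccontM; exact: PSLgram_cont.
by apply: ccontN; apply: ccontM; exact: PSLgram_cont.
Qed.

Lemma be_cont : continuous (fun x : G => be (PSLgram x)).
Proof. exact: be_ccont.1. Qed.

Lemma kk_ccont : ccont (fun x : G => kk (PSLgram x)).
Proof.
apply: ccontD; first by apply: ccontM; exact: PSLgram_cont.
by apply: ccontN; apply: ccontM; exact: PSLgram_cont.
Qed.

Lemma mul_const_cont (c : R) (f : G -> R) : continuous f -> continuous (fun x => c * f x).
Proof.
have cc : continuous (fun _ : G => c) by exact: cst_continuous.
by move=> cf x; exact: (cvgM (cc x) (cf x)).
Qed.

Lemma sqr_cont (f : G -> R) : continuous f -> continuous (fun x => f x ^+ 2).
Proof.
by move=> cf; under eq_fun do rewrite expr2; move=> x; exact: (cvgM (cf x) (cf x)).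
Qed.

Lemma measurable_siegel : mb [set x : G | siegel (PSLgram x)].
Proof.
have ca := al_cont; have cb := be_cont; have cp := @PSLgram_cont R 1 2.
have cs := @PSLgram_cont R 0 2; have ck := kk_ccont.
rewrite (_ : [set x | _] =
  [set x : G | al (PSLgram x) ^+ 2 <= 2 * be (PSLgram x)] `&`
  [set x : G | be (PSLgram x) ^+ 2 <= 2 * al (PSLgram x)] `&`
  [set x : G | al (PSLgram x) <= Re (PSLgram x 1 2) < 2 * al (PSLgram x)] `&`
  [set x : G | be (PSLgram x) <= Re (kk (PSLgram x)) < 2 * be (PSLgram x)] `&`
  [set x : G | nsq (PSLgram x 1 2) <= 5 * al (PSLgram x) ^+ 2] `&`
  [set x : G | nsq (kk (PSLgram x)) <= 5 * be (PSLgram x) ^+ 2] `&`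
  [set x : G | nsq (PSLgram x 0 2) <= 5 * al (PSLgram x) ^+ 2]); last first.
  apply/seteqP; split=> x /=; first by move=> [? ? ? ? [? ? ?]]; do !split.
  by move=> [[[[[[? ?] ?] ?] ?] ?] ?]; split.
do ?[apply: measurableI].
- by apply: measurable_le; [exact: sqr_cont|exact: mul_const_cont].
- by apply: measurable_le; [exact: sqr_cont|exact: mul_const_cont].
- by apply: measurable_lelt => //; [exact: cp.1|exact: mul_const_cont].
- by apply: measurable_lelt => //; [exact: ck.1|exact: mul_const_cont].
- by apply: measurable_le; [exact: nsq_cont|apply: mul_const_cont; exact: sqr_cont].
- by apply: measurable_le; [exact: nsq_cont|apply: mul_const_cont; exact: sqr_cont].
- by apply: measurable_le; [exact: nsq_cont|apply: mul_const_cont; exact: sqr_cont].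
Qed.

Lemma measurable_piece n1 n2 : mb [set x : G | piece n1 n2 (PSLgram x)].
Proof.
have ca := al_cont; have cb := be_cont.
have mc (c : R) (f : G -> R) : continuous f -> continuous (fun x => f x * c).
  by move=> cf; under eq_fun do rewrite mulrC; exact: mul_const_cont.
rewrite (_ : [set x | _] = [set x : G | siegel (PSLgram x)] `&`
  [set x : G | al (PSLgram x) ^+ 2 * 64 ^+ n2 <= 2 * be (PSLgram x)
               < al (PSLgram x) ^+ 2 * 64 ^+ n2.+1] `&`
  [set x : G | be (PSLgram x) ^+ 2 * 64 ^+ n1 <= 2 * al (PSLgram x)
               < be (PSLgram x) ^+ 2 * 64 ^+ n1.+1]); last first.
  apply/seteqP; split=> x /=; first by move=> [? ? ?].
  by move=> [[? ?] ?].
apply: measurableI; first apply: measurableI; first exact: measurable_siegel.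
  by apply: measurable_lelt;
    [apply: mc; exact: sqr_cont|exact: mul_const_cont|apply: mc; exact: sqr_cont].
by apply: measurable_lelt;
    [apply: mc; exact: sqr_cont|exact: mul_const_cont|apply: mc; exact: sqr_cont].
Qed.

Definition bounded_part : set G := [set x | forall i, Re (PSLgram x i i) <= 2400].

Lemma measurable_bounded_part : mb bounded_part.
Proof.
rewrite (_ : bounded_part = \bigcap_(i in [set: 'I_3]) [set x : G | Re (PSLgram x i i) <= 2400]).
  apply: closed_Borel; apply: closed_bigI => i _; apply: closed_le_cont.
    exact: (@PSLgram_cont R i i).1.
  exact: cst_continuous.
by apply/seteqP; split=> x H i; [move=> _|]; exact: H.
Qed.

Lemma PSLgram_hermitian1 (x : G) : hermitian1 (PSLgram x).
Proof. exact: hermitian1_gram. Qed.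

(** Translated by [diagSL], the pieces are pairwise disjoint subsets of one
    compact set. *)
Theorem siegel_measure_finite (mu : {measure set (Borel G) -> \bar R}) :
  left_haar_measure mu -> (mu [set x : G | siegel (PSLgram x)] < +oo)%E.
Proof.
move=> haar; have [_ muK _] := haar.
apply: (@le_lt_trans _ _ (mu bounded_part)); last first.
  by apply: muK; exact: compact_gram_le.
pose S k : set G := if @pickle_inv (nat * nat)%type k is Some (n1, n2)
  then [set x | piece n1 n2 (PSLgram x)] else set0.
pose g k : G := if @pickle_inv (nat * nat)%type k is Some (n1, n2)
  then PSL_class (diagSL n1 n2) else 1%g.
have -> : [set x : G | siegel (PSLgram x)] = \bigcup_k S k.
  apply/seteqP; split=> x /=.
    have [_ _ a0 b0] := PSLgram_hermitian1 x.
    move=> /(siegel_piece a0 b0) [n1 [n2 hx]]; exists (pickle (n1, n2)) => //.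
    by rewrite /S pickleK_inv.
  by move=> [k _]; rewrite /S; case: pickle_inv => [[n1 n2] []|].
have image k y : [set g k * x | x in S k]%g y -> exists n1 n2,
    [/\ pickle_inv k = Some (n1, n2), hermitian1 (PSLgram y) &
     exists h, [/\ 0 < al h, 0 < be h, piece n1 n2 h &
                PSLgram y = act (SLval (diagSL n1 n2)) h]].
  rewrite /g /S; case: pickle_inv => [[n1 n2]|]; last by move=> [x []].
  move=> [x hx <-]; exists n1, n2; split=> //; first exact: PSLgram_hermitian1.
  have [_ _ a0 b0] := PSLgram_hermitian1 x.
  by exists (PSLgram x); split=> //; exact: PSLgramM.
apply: (piecewise_translate_le (@PSL_mul_cont R) haar (g := g)).
- move=> k; rewrite /S; case: pickle_inv => [[n1 n2]|]; last exact: measurable0.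
  exact: measurable_piece.
- exact: measurable_bounded_part.
- move=> k l _ _ [y [/image [n1 [n2 [kE [hh _ a0 b0] [h [ah bh ph yE]]]]]]].
  move=> /image [m1 [m2 [lE _ [h' [ah' bh' ph' yE']]]]].
  have [+ + _ _ _] := act_piece ah bh ph; rewrite -yE => u1 u2.
  have [+ + _ _ _] := act_piece ah' bh' ph'; rewrite -yE' => v1 v2.
  have e2 := dyadic_unique a0 u1 v1; have e1 := dyadic_unique b0 u2 v2.
  have := @pickle_invK (nat * nat)%type k; rewrite kE /= => <-.
  by have := @pickle_invK (nat * nat)%type l; rewrite lE /= => <-; rewrite e1 e2.
- move=> k y /image [n1 [n2 [_ hh [h [ah bh ph yE]]]]].
  have [_ _ h1 h2 [h3 h4 h5]] := act_piece ah bh ph; rewrite -yE in h1 h2 h3 h4 h5.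
  exact: bounded_diag.
Qed.
End SiegelMeasure.

(** * The theorem *)

Section Covolume.
Variables (R : realType) (omega : R[i]) (L : set (PSL R 3)).
Hypothesis homega : 3.-primitive_root omega.
Local Notation O := (Zadjoin omega).
Local Notation P := (PSL_over (n := 3) O).
Local Notation G := (PSL R 3).
Hypothesis Lsub : is_subgroup L.
Hypothesis Lfin : finite_index P (P `&` L).

Let coset (h : G) : set G := [set h * k | k in P `&` L]%g.
Let cosets : set (set G) := [set coset h | h in P].
Let rep_of (c : set G) : G := xget 1%g c.
Let siegelP : set G := [set x | siegel (PSLgram x)].

(** P is a finite union of cosets h (P n L), and the translates of the Siegel
    set by P cover the group; hence its translates by these h^-1 meet every
    orbit of L. *)
Let S : set G := \bigcup_(c in cosets) [set (rep_of c)^-1 * x | x in siegelP]%g.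

Lemma S_meets g : exists2 l, L l & S (l * g)%g.
Proof.
have [P1 PM PV] := PSL_over_subgroup homega; have [L1 LM LV] := Lsub.
have [M OM' hM] := siegel_reduction homega (PSL_repr g).
have PM' : P (PSL_class M) by exists M.
pose c := coset (PSL_class M).
have cM : c (PSL_class M) by exists 1%g; [split|rewrite mulg1].
have [k [Pk Lk] kE] : c (rep_of c) by rewrite /rep_of; case: xgetP => [x -> //|/(_ _ cM)].
exists k^-1%g; first exact: LV.
exists c; first by exists (PSL_class M).
exists (PSL_class M * g)%g.
  by rewrite /siegelP /= -(PSL_reprK g) PSL_classM PSLgram_class.
by rewrite -kE invgM -!mulgA mulKg.
Qed.

Lemma covolume_finite (I : countType) (w : I -> G) (V : nat -> set G) :
  L = range w -> (forall n, open (V n)) -> (forall x, exists n, V n x) ->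
  (forall n x l, L l -> V n x -> V n (l * x)%g -> l = 1%g) ->
  finite_covolume R L.
Proof.
move=> Lw oV covV freeV mu haar.
have mcoset c : measurable ([set (rep_of c)^-1 * x | x in siegelP]%g : set (Borel G)).
  by apply: (translate_Borel (@PSL_mul_cont R)); exact: measurable_siegel.
have mS : measurable (S : set (Borel G)) by apply: fin_bigcup_measurable.
have [F [mF fF FS]] := fundamental_domain_of_cover (@PSL_mul_cont R) Lsub Lw mS S_meets
  (fun n => open_Borel (oV n)) covV freeV.
exists F; split=> //; apply: (@le_lt_trans _ _ (mu S)).
  by apply: le_measure; rewrite ?inE.
apply: (@le_lt_trans _ _ (\sum_(c \in cosets) mu [set (rep_of c)^-1 * x | x in siegelP]%g)%E).
  exact: content_sub_fsum.
rewrite fsbig_finite //=.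
apply: lte_sum_pinfty => c _; have [muL _ _] := haar.
by rewrite muL; [exact: siegel_measure_finite|exact: measurable_siegel].
Qed.
End Covolume.

Lemma Gamma_gens (Q : set Gamma) : Q 1%g ->
  (forall x y, Q x -> Q y -> Q (x * y)%g) ->
  Q Gamma_a -> Q Gamma_b -> Q (Gamma_a^-1)%g -> Q (Gamma_b^-1)%g -> forall x, Q x.
Proof.
move=> Q1 QM Qa Qb Qa' Qb' x; rewrite -(presented_reprK x).
elim: (repr x) => [|[y e] w IH]; first exact: Q1.
rewrite -[(y, e) :: w]cat1s -presented_mulE; apply: QM => //.
have inv z : presented_pi Gamma_rels [:: (z, false)] = ((presented_gen Gamma_rels z : Gamma)^-1)%g.
  apply/esym/(@mulg1_eq Gamma); rewrite [LHS]presented_mulE.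
  by apply/presented_piP; exact: (word_eq_cancel _ z true).
case: y e => [] [].
- exact: Qa.
- by rewrite inv.
- exact: Qb.
- by rewrite inv.
Qed.

Theorem corollary2 (R : realType) (omega r : R[i])
    (homega : 3.-primitive_root omega)
    (hr : r ^+ 3 = 1 - omega)
    (pi : {multiplicative Gamma -> PSL R 3})
    (hpi_a : PSL_class_of (mxA omega r) (pi Gamma_a))
    (hpi_b : PSL_class_of (mxB omega r) (pi Gamma_b)) :
  arithmetic_lattice omega (range pi).
Proof.
have piM x y : pi (x * y)%g = (pi x * pi y)%g by exact: gmulfM.
have pi1 : pi 1%g = 1%g by apply: (@mulgI _ (pi 1%g)); rewrite -piM !mulg1.
have piV x : pi x^-1%g = (pi x)^-1%g.
  by apply/esym/(@mulg1_eq (PSL R 3)); rewrite -piM mulgV.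
have Lsub : is_subgroup (range pi).
  split.
  - by exists 1%g.
  - by move=> _ _ [x _ <-] [y _ <-]; exists (x * y)%g.
  - by move=> _ [x _ <-]; exists x^-1%g.
have La : range pi (pi Gamma_a) by exists Gamma_a.
have Lb : range pi (pi Gamma_b) by exists Gamma_b.
have core : range pi `<=` near_core omega (pi Gamma_b).
  move=> _ [x _ <-]; apply: (@Gamma_gens [set x | near_core omega (pi Gamma_b) (pi x)]) => /=.
  - by rewrite pi1; exists 0%N; rewrite expg0 mulg1; exact: Pcore1.
  - by move=> y z hy hz; rewrite piM; exact: near_coreM.
  - exact: (near_core_a homega hr hpi_a hpi_b).
  - exact: (near_core_b homega hr hpi_a hpi_b).
  - by rewrite piV; exact: (near_core_aV homega hr hpi_a hpi_b).
  - by rewrite piV; exact: near_core_bV.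
have fin := finite_index_integral homega hr hpi_a hpi_b Lsub La Lb.
split; last first.
  split; rewrite setIC //.
  exact: (near_core_in homega hr hpi_a hpi_b Lsub Lb core).
have e0 : 0 < sep_radius R by rewrite invr_gt0 exprn_gt0.
have sep (M : SL R 3) : range pi (PSL_class M) ->
    (forall i j, nsq (SLval M i j - (i == j)%:R) < sep_radius R) -> PSL_class M = 1%g.
  move=> /core hM; apply: (separation homega hr hpi_b).
  exact: (near_core_lt3 homega hr hpi_a hpi_b hM).
have [V [oV covV freeV]] := free_cover e0 sep.
split=> //; first exact: subgroup_discrete Lsub e0 sep.
apply: (covolume_finite homega Lsub fin
  (w := fun w : word bool => pi (presented_pi Gamma_rels w)) _ oV covV freeV).
apply/seteqP; split=> [_ [x _ <-]|_ [w _ <-]].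
  by exists (repr x) => //; rewrite presented_reprK.
by exists (presented_pi Gamma_rels w).
Qed.
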